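(* Let $G$ be an undirected connected graph with $N\ge 2$ nodes, $M$ edges and incidence matrix $D\in\mathbb{R}^{N\times M}$. Let $A\in\mathbb{R}^{n\times n}$, $B\in\mathbb{R}^{n\times p}$ of full column rank, $C\in\mathbb{R}^{p\times n}$, and suppose there is a matrix $P=P^T>0$ with $A^TP+PA\le 0$ and $B^TP=C$. Assume that $(C,A)$ is detectable, and let $\Delta>0$. Then for any Krasowskii solution $\xi(t)\in\mathbb{R}^{nN}$ to $$\dot\xi=(I_N\otimes A)\xi-(I_N\otimes B)(D\otimes I_p)\,\mathsf q\big((D^T\otimes I_p)(I_N\otimes C)\xi\big)$$ there exists a finite time $T$ such that $$\frac{1}{\sqrt{pM}}\left\|\xi(t)-(\mathbf 1_N\otimes I_n)\frac{(\mathbf 1_N^T\otimes I_n)\xi(t)}{N}\right\|\le 2\sqrt{\frac{c_2}{c_1}}\,\|R\|\,\|B\|\,\|D\otimes I_p\|\,\Delta\qquad\text{for all } t\ge T,$$ where $R$ and the constants $c_1,c_2>0$ are as defined in the context. Moreover, $\frac{\mathbf 1_N^T\otimes I_n}{N}\xi(t)=\xi_0(t)$, where $\xi_0$ is the solution of $\dot\xi_0=A\xi_0$ with initial condition $\xi_0(0)=\frac{\mathbf 1_N^T\otimes I_n}{N}\xi(0)$.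
   Context: Incidence matrix: each edge $k$ of the undirected graph $G$ has one end labelled positive and the other negative (arbitrarily); $D=(d_{ik})$ with $d_{ik}=+1$ if node $i$ is the positive end of edge $k$, $-1$ if it is the negative end, $0$ otherwise. $\otimes$ is the Kronecker product; $\mathbf 1_N$ is the all-ones vector in $\mathbb{R}^N$; $\|\cdot\|$ is the Euclidean norm of vectors and the induced (spectral) norm of matrices. Quantizer: $\mathsf q(r)=\Delta\lfloor r/\Delta+1/2\rfloor$ for $r\in\mathbb{R}$; for vectors, $\mathsf q$ is applied componentwise. The matrix $R$: put $\Pi=I_N-\frac{\mathbf 1_N\mathbf 1_N^T}{N}$ and $\tilde A=I_N\otimes A-(I_N\otimes B)(DD^T\otimes I_p)(I_N\otimes C)$; then $$R:=\int_0^{+\infty}(\Pi\otimes I_n)^Te^{\tilde A^Ts}e^{\tilde As}(\Pi\otimes I_n)\,ds,$$ which is finite under the stated hypotheses. The constants $c_1,c_2>0$ are such that $c_1\|\tilde\xi\|^2\le\tilde\xi^TR\tilde\xi\le c_2\|\tilde\xi\|^2$ for every disagreement vector $\tilde\xi$, i.e. every $\tilde\xi$ in the range of $\Pi\otimes I_n$. Krasowskii solutions: for $\dot X=F(X)$ with possibly discontinuous $F$, a Krasowskii solution on an interval $I$ is an absolutely continuous function satisfying $\dot X(t)\in\bigcap_{\delta>0}\overline{\mathrm{co}}\,F(B(X(t),\delta))$ for a.e. $t\in I$, where $B(X,\delta)$ is the ball of radius $\delta$ centred at $X$ and $\overline{\mathrm{co}}$ is the closed convex hull. Solutions are considered on $[0,+\infty)$.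 *)

(* Defs.v *)
From HB Require Import structures.
From mathcomp Require Import all_boot all_order all_algebra.
From mathcomp Require Import all_classical all_reals all_analysis.
From mathcomp Require Import complex mxtens.

Set Implicit Arguments.
Unset Strict Implicit.
Unset Printing Implicit Defensive.

Import Order.TTheory GRing.Theory Num.Theory.
Import numFieldTopology.Exports numFieldNormedType.Exports.

Local Open Scope classical_set_scope.
Local Open Scope ring_scope.

Section Norms.
Context {R : realType}.

(* MathComp-Analysis equips matrices with the max norm, so the Euclidean norm
   and the operator norm it induces are defined here. *)
Definition enorm {d : nat} (x : 'cV[R]_d) : R :=
  Num.sqrt (\sum_(i < d) x i ord0 ^+ 2).

Definition opnorm {m d : nat} (X : 'M[R]_(m, d)) : R :=
  sup [set enorm (X *m x) | x in [set x : 'cV[R]_d | enorm x <= 1]].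

Definition qform {d : nat} (X : 'M[R]_d) (x : 'cV[R]_d) : R :=
  (x^T *m X *m x) ord0 ord0.

Definition posdef {d : nat} (X : 'M[R]_d) : Prop :=
  forall x : 'cV[R]_d, x != 0 -> 0 < qform X x.

Definition neg_semidef {d : nat} (X : 'M[R]_d) : Prop :=
  forall x : 'cV[R]_d, qform X x <= 0.

End Norms.

Section Graphs.
Context {R : realType}.

(* [pos k] and [neg k] are the positive and negative ends of edge [k]; the [M]
   indices enumerate the edges of [e] without repetition, hence [M] is the
   number of edges and the orientation is arbitrary. *)
Definition edge_labelling {N M : nat} (e : rel 'I_N) (pos neg : 'I_M -> 'I_N)
    : Prop :=
  injective (fun k => [set pos k; neg k]%SET) /\
  forall i j, e i j <-> exists k, [set i; j]%SET = [set pos k; neg k]%SET.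

Definition connected_graph {N : nat} (e : rel 'I_N) : Prop :=
  forall i j, connect e i j.

Definition incidence_mx {N M : nat} (pos neg : 'I_M -> 'I_N) : 'M[R]_(N, M) :=
  \matrix_(i, k) (if i == pos k then 1 else if i == neg k then -1 else 0).

End Graphs.

Section LinearSystems.
Context {R : realType}.

Definition hurwitz {n : nat} (A : 'M[R]_n) : Prop :=
  forall z : R[i], eigenvalue (map_mx (real_complex R) A) z -> complex.Re z < 0.

Definition detectable {n p : nat} (C : 'M[R]_(p, n)) (A : 'M[R]_n) : Prop :=
  exists L : 'M[R]_(n, p), hurwitz (A - L *m C).

Definition expmx {d : nat} (X : 'M[R]_d) : 'M[R]_d :=
  limn (series (fun k : nat => (k`!%:R)^-1 *: X ^+ k)).

(* Solutions on [0, +oo[; continuity at 0 together with the equation on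
   ]0, +oo[ gives the one-sided derivative at 0. *)
Definition linear_solution {n : nat} (A : 'M[R]_n) (x0 : 'cV[R]_n)
    (x : R -> 'cV[R]_n) : Prop :=
  [/\ x 0 = x0, {within `[0, +oo[, continuous x} &
      forall t : R, 0 < t -> is_derive t 1 x (A *m x t)].

End LinearSystems.

Section Krasowskii.
Context {R : realType} {d : nat}.
Local Notation V := 'cV[R]_d.

Definition eball (x : V) (delta : R) : set V := [set y | enorm (y - x) < delta].

Definition closed_convex_hull (S : set V) : set V :=
  \bigcap_(K in [set K : set V | [/\ closed K, convex_set K & S `<=` K]]) K.

Definition krasowskii (F : V -> V) (x : V) : set V :=
  \bigcap_(delta in [set delta : R | 0 < delta])
    closed_convex_hull (F @` eball x delta).

Definition absolutely_continuous (a b : R) (x : R -> V) : Prop :=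
  forall eps : R, 0 < eps -> exists2 delta : R, 0 < delta &
    forall (k : nat) (s t : 'I_k -> R),
      (forall i, [/\ a <= s i, s i < t i & t i <= b]) ->
      (forall i j, i != j -> t i <= s j \/ t j <= s i) ->
      \sum_(i < k) (t i - s i) < delta ->
      \sum_(i < k) enorm (x (t i) - x (s i)) < eps.

(* Only the values of [x] on [0, +oo[ matter; absolute continuity on this
   unbounded interval is required on its compact subintervals. *)
Definition krasowskii_solution (F : V -> V) (x : R -> V) : Prop :=
  (forall b : R, 0 < b -> absolutely_continuous 0 b x) /\
  {ae lebesgue_measure, forall t : R, 0 <= t ->
    derivable x t 1 /\ krasowskii F (x t) ('D_1 x t)}.

End Krasowskii.

Section Network.
Context {R : realType} {N M n p : nat}.
Variables (D : 'M[R]_(N, M)).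
Variables (A : 'M[R]_n) (B : 'M[R]_(n, p)) (C : 'M[R]_(p, n)).

Definition quantizer (Delta r : R) : R :=
  Delta * (Num.floor (r / Delta + 2^-1))%:~R.

Definition quantized_field (Delta : R) (xi : 'cV[R]_(N * n)) : 'cV[R]_(N * n) :=
  (1%:M *t A) *m xi
  - (1%:M *t B) *m ((D *t 1%:M) *m
      map_mx (quantizer Delta) ((D^T *t 1%:M) *m ((1%:M *t C) *m xi))).

Definition ones : 'cV[R]_N := const_mx 1.

Definition Pi_mx : 'M[R]_N := 1%:M - N%:R^-1 *: (ones *m ones^T).

Definition disagreement_mx : 'M[R]_(N * n) := Pi_mx *t (1%:M : 'M[R]_n).

Definition A_tilde : 'M[R]_(N * n) :=
  (1%:M *t A) - (1%:M *t B) *m ((D *m D^T) *t 1%:M) *m (1%:M *t C).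

Definition R_mx : 'M[R]_(N * n) :=
  \matrix_(i, j) \int[lebesgue_measure]_(s in `[0, +oo[)
    (disagreement_mx^T *m expmx (s *: A_tilde^T) *m expmx (s *: A_tilde)
       *m disagreement_mx) i j.

(* (1_N^T (x) I_n) xi / N has [1 * n] rows, not convertible to [n]; [average]
   is the same vector in R^n. *)
Definition kron_average (xi : 'cV[R]_(N * n)) : 'cV[R]_(1 * n) :=
  N%:R^-1 *: ((ones^T *t (1%:M : 'M[R]_n)) *m xi).

Definition average (xi : 'cV[R]_(N * n)) : 'cV[R]_n :=
  castmx (mul1n n, erefl 1%N) (kron_average xi).

End Network.

(* Main.v *)
Require Import Defs.
From HB Require Import structures.
From mathcomp Require Import all_boot all_order all_algebra.
From mathcomp Require Import all_classical all_reals all_analysis.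
From mathcomp Require Import measurable_realfun complex mxtens ring lra.

Set Implicit Arguments.
Unset Strict Implicit.
Unset Printing Implicit Defensive.

Import Order.TTheory GRing.Theory Num.Theory.
Import numFieldTopology.Exports numFieldNormedType.Exports.
Local Open Scope classical_set_scope.
Local Open Scope ring_scope.

(* Let x = (Pi (x) I) xi be the disagreement and M = A~ - J (x) I with
   J = 1 1^T / N.  The function xi^T (I (x) P) xi is a weak Lyapunov function of M;
   where its dissipation S vanishes the outputs C x_i agree and sum to zero, so
   detectability leaves no eigenvector of M in the kernel of S, and the sum of
   (M^k)^T (I (x) P) M^k over k < nN is a strict Lyapunov function.  Hence
   e^{A~ s} (Pi (x) I) decays exponentially, and the fundamental theorem of calculus
   gives A~^T R + R A~ = - Pi (x) I.
   A quantizer changes its argument by at most Delta / 2, so the Krasowskii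
   inclusion gives, almost everywhere and for b = sqrt(pM) ||R|| ||B|| ||D (x) I|| Delta,
   (x^T R x)' <= - |x|^2 + b |x| <= - x^T R x / (2 c2) + b^2 / 2,
   and x^T R x is eventually at most any number above c2 b^2, in particular 4 c2 b^2.
   Almost everywhere differential inequalities are integrated by comparing
   absolutely continuous functions along a Cousin partition.  The quantized input
   is orthogonal to the average because 1^T D = 0. *)

(** [A~] itself need not be stable: on the consensus subspace it acts as [A], which may have
    eigenvalues on the imaginary axis. Subtracting [J (x) I] replaces [A] there by [A - I] and
    changes nothing on the range of [Pi (x) I], so decay of the disagreement becomes a statement
    about a whole matrix [M]. Its dissipation gains the term 2 (J z)^T (I (x) P) (J z), and this
    term is what forces the outputs to sum to zero. For an eigenvector in the kernel of [S], each
    nonzero block is an eigenvector of [A] invisible to [C]: detectability asks for a negative real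
    part, while the vanishing dissipation conserves the energy and asks for a zero one. Exponential
    decay alone gives an asymptotic bound. The finite [T] comes from the gap between c2 b^2 and 4 c2
    b^2, which is open only if b > 0; hence the proofs that [R], [B] and [D (x) I] do not vanish,
    and the separate case pM = 0. *)

(** * Euclidean geometry, semidefinite forms and the operator norm *)

Section InnerProduct.
Context {R : realType}.

Definition dot {d : nat} (x y : 'cV[R]_d) : R := (x^T *m y) ord0 ord0.

Section Dot.
Context {d : nat}.
Implicit Types (x y z : 'cV[R]_d) (X : 'M[R]_d).

Lemma dotE x y : dot x y = \sum_i x i ord0 * y i ord0.
Proof. by rewrite /dot mxE; apply: eq_bigr => i _; rewrite mxE. Qed.

Lemma dotC x y : dot x y = dot y x.
Proof. by rewrite !dotE; apply: eq_bigr => i _; rewrite mulrC. Qed.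

Lemma dotDl x y z : dot (x + y) z = dot x z + dot y z.
Proof. by rewrite /dot linearD mulmxDl mxE. Qed.

Lemma dotDr x y z : dot x (y + z) = dot x y + dot x z.
Proof. by rewrite dotC dotDl !(dotC x). Qed.

Lemma dotZl a x y : dot (a *: x) y = a * dot x y.
Proof. by rewrite /dot linearZ -scalemxAl mxE. Qed.

Lemma dotZr a x y : dot x (a *: y) = a * dot x y.
Proof. by rewrite dotC dotZl dotC. Qed.

Lemma dotNl x y : dot (- x) y = - dot x y.
Proof. by rewrite -scaleN1r dotZl mulN1r. Qed.

Lemma dotNr x y : dot x (- y) = - dot x y.
Proof. by rewrite dotC dotNl dotC. Qed.

Lemma dot0l x : dot 0 x = 0.
Proof. by rewrite /dot trmx0 mul0mx mxE. Qed.

Lemma dot0r x : dot x 0 = 0.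
Proof. by rewrite dotC dot0l. Qed.

Lemma dot_ge0 x : 0 <= dot x x.
Proof. by rewrite dotE; apply: sumr_ge0 => i _; rewrite -expr2 sqr_ge0. Qed.

Lemma dot_eq0 x : dot x x = 0 -> x = 0.
Proof.
rewrite dotE => /eqP; rewrite psumr_eq0; last by move=> i _; rewrite -expr2 sqr_ge0.
move=> /allP x0; apply/colP => i; rewrite mxE.
by have /(_ (mem_index_enum i)) := x0 i; rewrite mulf_eq0 orbb => /eqP.
Qed.

Lemma qformE X x : qform X x = dot x (X *m x).
Proof. by rewrite /qform /dot mulmxA. Qed.

Lemma enormE x : enorm x = Num.sqrt (dot x x).
Proof. by rewrite /enorm dotE; under eq_bigr do rewrite expr2. Qed.

Lemma enorm_sqr x : enorm x ^+ 2 = dot x x.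
Proof. by rewrite enormE sqr_sqrtr ?dot_ge0. Qed.

Lemma enorm_ge0 x : 0 <= enorm x.
Proof. by rewrite enormE sqrtr_ge0. Qed.

Lemma enorm_eq0 x : enorm x = 0 -> x = 0.
Proof. by move=> x0; apply: dot_eq0; rewrite -enorm_sqr x0 expr0n. Qed.

Lemma enorm0 : enorm (0 : 'cV[R]_d) = 0.
Proof. by rewrite enormE dot0l sqrtr0. Qed.

Lemma enorm_gt0 x : x != 0 -> 0 < enorm x.
Proof.
move=> x0; rewrite lt_def enorm_ge0 andbT.
by apply: contra x0 => /eqP/enorm_eq0 ->.
Qed.

Lemma enormZ a x : enorm (a *: x) = `|a| * enorm x.
Proof.
by rewrite !enormE dotZl dotZr mulrA -expr2 sqrtrM ?sqr_ge0// sqrtr_sqr.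
Qed.

Lemma enormN x : enorm (- x) = enorm x.
Proof. by rewrite -scaleN1r enormZ normrN1 mul1r. Qed.

Definition psd X := X^T = X /\ forall x, 0 <= qform X x.

End Dot.

Lemma dot_mull {m d : nat} (X : 'M[R]_(m, d)) x y :
  dot (X *m x) y = dot x (X^T *m y).
Proof. by rewrite /dot trmx_mul mulmxA. Qed.

Lemma dot_mulr {m d : nat} (X : 'M[R]_(m, d)) x y :
  dot x (X *m y) = dot (X^T *m x) y.
Proof. by rewrite dot_mull trmxK. Qed.

Section PSD.
Context {d : nat}.
Implicit Types (x y z : 'cV[R]_d) (X : 'M[R]_d).

Lemma qformD_sym X x y : X^T = X ->
  qform X (x + y) = qform X x + 2 * dot x (X *m y) + qform X y.
Proof.
move=> sX; rewrite !qformE mulmxDr dotDl !dotDr (dotC y) dot_mull sX.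
ring.
Qed.

Lemma qformZ X a x : qform X (a *: x) = a ^+ 2 * qform X x.
Proof. by rewrite !qformE -scalemxAr dotZl dotZr mulrA. Qed.

(** The discriminant argument for the polynomial [qform X (x + t *: y)] in [t], which is nowhere
    negative. *)
Lemma psd_CauchySchwarz X x y : psd X ->
  dot x (X *m y) ^+ 2 <= qform X x * qform X y.
Proof.
move=> [sX pX]; set b := dot _ _.
have H t : 0 <= qform X x + 2 * t * b + t ^+ 2 * qform X y.
  have := pX (x + t *: y); rewrite qformD_sym// qformZ -scalemxAr dotZr.
  by rewrite mulrA.
have [c0|c0] := eqVneq (qform X y) 0.
  rewrite c0 mulr0; have [->|b0] := eqVneq b 0; first by rewrite expr0n.
  (* The polynomial is affine in this case, and this [t] gives it the value -1. *)
  have := H (- (qform X x + 1) / (2 * b)); rewrite c0 mulr0 addr0.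
  suff -> : 2 * (- (qform X x + 1) / (2 * b)) * b = - (qform X x + 1) by lra.
  by field.
have c1 : 0 < qform X y by rewrite lt_def c0 pX.
(* The minimiser of the polynomial. *)
have := H (- b / qform X y).
have -> : qform X x + 2 * (- b / qform X y) * b + (- b / qform X y) ^+ 2 * qform X y
   = (qform X x * qform X y - b ^+ 2) / qform X y by field.
by rewrite pmulr_lge0 ?invr_gt0// subr_ge0.
Qed.

(** Cauchy-Schwarz with first argument [X *m x] bounds the fourth power of its norm by a multiple of
    [qform X x]. *)
Lemma psd_kernel X x : psd X -> qform X x = 0 -> X *m x = 0.
Proof.
move=> pX x0; apply: dot_eq0; have := psd_CauchySchwarz (X *m x) x pX.
by rewrite x0 mulr0 le_eqVlt ltNge sqr_ge0 orbF sqrf_eq0 => /eqP.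
Qed.

Lemma dot_le_enorm x y : dot x y <= enorm x * enorm y.
Proof.
have [sI pI] : psd (1%:M : 'M[R]_d).
  by split=> [|z]; rewrite ?trmx1// qformE mul1mx dot_ge0.
have := psd_CauchySchwarz x y (conj sI pI).
rewrite !qformE !mul1mx => H; rewrite (le_trans (ler_norm _))//.
rewrite -(ler_pXn2r (n := 2))// ?nnegrE ?mulr_ge0 ?enorm_ge0//.
by rewrite exprMn !enorm_sqr real_normK ?num_real.
Qed.

End PSD.

Section OperatorNorm.
Context {m d : nat}.
Implicit Type X : 'M[R]_(m, d).

(** [K] is the Frobenius norm. Some finite bound must exist before the supremum in [opnorm] can be
    used. *)
Lemma enorm_mulmx_bounded X :
  exists2 K, 0 <= K & forall x, enorm (X *m x) <= K * enorm x.
Proof.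
pose S := \sum_i dot (row i X)^T (row i X)^T.
have S0 : 0 <= S by apply: sumr_ge0 => i _; exact: dot_ge0.
exists (Num.sqrt S); first exact: sqrtr_ge0.
move=> x; rewrite -(ler_pXn2r (n := 2)) ?nnegrE ?mulr_ge0 ?sqrtr_ge0 ?enorm_ge0//.
rewrite exprMn (sqr_sqrtr S0) enorm_sqr dotE /S mulr_suml; apply: ler_sum => i _.
have -> : (X *m x) i ord0 = dot (row i X)^T x.
  by rewrite mxE dotE; apply: eq_bigr => j _; rewrite !mxE.
rewrite -expr2 -!enorm_sqr -exprMn -ler_sqrt ?sqr_ge0// !sqrtr_sqr.
rewrite (ger0_norm (mulr_ge0 _ _)) ?enorm_ge0// ler_norml dot_le_enorm andbT.
by rewrite lerNl -dotNl (le_trans (dot_le_enorm _ _))// enormN.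
Qed.

Lemma opnorm_has_sup X :
  has_sup [set enorm (X *m x) | x in [set x : 'cV[R]_d | enorm x <= 1]].
Proof.
split; first by exists (enorm (X *m 0)), 0 => //=; rewrite enorm0.
have [K K0 XK] := enorm_mulmx_bounded X; exists K => _ [x /= x1 <-].
by rewrite (le_trans (XK x))// ler_piMr.
Qed.

Lemma opnorm_ge0 X : 0 <= opnorm X.
Proof.
have -> : 0 = enorm (X *m 0) by rewrite mulmx0 enorm0.
by apply: sup_upper_bound (opnorm_has_sup X) _ _; exists 0 => //=; rewrite enorm0.
Qed.

Lemma enorm_mulmx_le X x : enorm (X *m x) <= opnorm X * enorm x.
Proof.
have [->|x0] := eqVneq x 0; first by rewrite mulmx0 !enorm0 mulr0.
have n0 := enorm_gt0 x0; rewrite -ler_pdivrMr//.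
have -> : enorm (X *m x) / enorm x = enorm (X *m ((enorm x)^-1 *: x)).
  by rewrite -scalemxAr enormZ gtr0_norm ?invr_gt0// mulrC.
apply: sup_upper_bound (opnorm_has_sup X) _ _; exists ((enorm x)^-1 *: x) => //=.
by rewrite enormZ gtr0_norm ?invr_gt0// mulVf ?gt_eqF.
Qed.

Lemma opnorm_gt0 X : X != 0 -> 0 < opnorm X.
Proof.
move=> X0; rewrite lt_def opnorm_ge0 andbT; apply: contra X0 => /eqP oX.
apply/eqP/matrixP => i j; rewrite mxE.
have : col j X = 0.
  apply: enorm_eq0; apply/eqP; rewrite eq_le enorm_ge0 andbT colE.
  by rewrite (le_trans (enorm_mulmx_le _ _))// oX mul0r.
by move=> /matrixP/(_ i ord0); rewrite !mxE.
Qed.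

(** Duality: |X^T y|^2 is the inner product of y with X (X^T y), to which the bound for [X]
    applies. *)
Lemma enorm_trmx_mulmx_le X y : enorm (X^T *m y) <= opnorm X * enorm y.
Proof.
have [e0|e0] := eqVneq (X^T *m y) 0.
  by rewrite e0 enorm0 mulr_ge0 ?opnorm_ge0 ?enorm_ge0.
rewrite -(ler_pM2r (enorm_gt0 e0)) -expr2 enorm_sqr dot_mull trmxK.
rewrite (le_trans (dot_le_enorm _ _))//.
by have := enorm_mulmx_le X (X^T *m y); have := enorm_ge0 y; nra.
Qed.

End OperatorNorm.

(** Neither compactness nor a spectral decomposition is used: Cauchy-Schwarz for the form gives |X
    x|^2 <= K x^T X x, and invertibility of [X] gives |x| <= L |X x|. *)
Lemma posdef_coercive {d : nat} (X : 'M[R]_d) : X^T = X -> posdef X ->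
  exists2 eta, 0 < eta & forall x, eta * dot x x <= qform X x.
Proof.
move=> sX pX.
have psdX : psd X.
  split=> // x; have [->|x0] := eqVneq x 0; first by rewrite qformE dot0l.
  exact/ltW/pX.
have [K K0 XK] := enorm_mulmx_bounded X.
have uX : X \in unitmx.
  rewrite -row_free_unit -kermx_eq0; apply/eqP/row_matrixP => i; rewrite row0.
  have : X *m (row i (kermx X))^T = 0.
    by rewrite -{1}sX -trmx_mul -row_mul mulmx_ker row0 trmx0.
  move=> h; apply/trmx_inj; rewrite trmx0; apply/eqP/negPn/negP => /pX.
  by rewrite qformE h dot0r ltxx.
have [L L0 XL] := enorm_mulmx_bounded (invmx X).
have H x : dot x x <= L ^+ 2 * K * qform X x.
  have h1 : dot (X *m x) (X *m x) <= K * qform X x.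
    have [/eqP|e0] := eqVneq (X *m x) 0.
      by move/eqP=> ->; rewrite dot0l mulr_ge0 ?psdX.2.
    have e1 : 0 < dot (X *m x) (X *m x) by rewrite -enorm_sqr exprn_gt0 ?enorm_gt0.
    have := psd_CauchySchwarz (X *m x) x psdX.
    have h3 : qform X (X *m x) <= K * dot (X *m x) (X *m x).
      rewrite qformE (le_trans (dot_le_enorm _ _))// -enorm_sqr.
      by have := XK (X *m x); have := enorm_ge0 (X *m x); nra.
    have h2 := psdX.2 x; rewrite expr2 => h4.
    rewrite -(ler_pM2l e1) (le_trans h4)// mulrCA mulrA ler_wpM2r//.
  have h5 := XL (X *m x); rewrite mulKmx// in h5.
  rewrite -mulrA (le_trans _ (ler_wpM2l (sqr_ge0 L) h1))//.
  rewrite -!enorm_sqr -exprMn lerXn2r ?nnegrE ?mulr_ge0 ?enorm_ge0//.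
(* The summand 1 keeps the inverted quantity positive even if [L ^+ 2 * K] is zero. *)
exists (L ^+ 2 * K + 1)^-1; first by rewrite invr_gt0 ltr_wpDl// mulr_ge0// sqr_ge0.
move=> x; rewrite mulrC ler_pdivrMr ?ltr_wpDl// ?mulr_ge0// ?sqr_ge0//.
by rewrite mulrDr mulr1 mulrC (le_trans (H x))// lerDl psdX.2.
Qed.

End InnerProduct.

(** * Strict Lyapunov functions *)

Section UnobservableEigenvector.

(** By Cayley-Hamilton the product of the M - z over the roots z kills [v]. Applying the factors one
    at a time, the last nonzero vector is an eigenvector; as a polynomial in [M] of low degree
    applied to [v], it stays in the kernel of [S]. *)
Lemma closed_field_eigenvector_in_kernel (F : closedFieldType) (n : nat)
    (M S : 'M[F]_n.+1) (v : 'cV[F]_n.+1) :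
  v != 0 -> (forall k, (k < n.+1)%N -> S *m (M ^+ k *m v) = 0) ->
  exists lam, exists w : 'cV[F]_n.+1, [/\ w != 0, M *m w = lam *: w & S *m w = 0].
Proof.
move=> v0 Sv; have [r Er] := closed_field_poly_normal (char_poly M).
rewrite (monicP (char_poly_monic M)) scale1r in Er.
have szr : size r = n.+1.
  by have := size_char_poly M; rewrite Er size_prod_XsubC => -[].
have : horner_mx M (\prod_(z <- r) ('X - z%:P)) *m v = 0.
  by rewrite -Er; have := Cayley_Hamilton M => ->; rewrite mul0mx.
have : (size r <= n.+1)%N by rewrite szr.
elim: r {Er szr} => [_|z r IH rn].
  by rewrite big_nil rmorph1 mul1mx => v1; rewrite v1 eqxx in v0.
rewrite big_cons rmorphM /= -mulmxE -mulmxA rmorphB /= horner_mx_X horner_mx_C.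
set w := horner_mx _ _ *m v.
have [w0 _|w0] := eqVneq w 0; first exact: IH (ltnW rn) w0.
rewrite mulmxBl mul_scalar_mx => /eqP; rewrite subr_eq0 => /eqP Mw.
exists z, w; split => //; rewrite /w; set q := \prod_(_ <- _) _.
(* At least one root has been split off, so only powers of [M] covered by [Sv] occur in [q]. *)
have sq : (size q <= n.+1)%N by rewrite size_prod_XsubC.
rewrite -[q]coefK poly_def rmorph_sum mulmx_suml mulmx_sumr big1// => i _.
rewrite -mul_polyC rmorphM rmorphXn /= horner_mx_X horner_mx_C -mulmxE mul_scalar_mx -scalemxAl -scalemxAr Sv ?scaler0//.
exact: leq_trans (ltn_ord i) sq.
Qed.

Context {R : realType}.
Local Notation toC := (map_mx (real_complex R)).
Local Notation mRe := (map_mx (@complex.Re R)).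
Local Notation mIm := (map_mx (@complex.Im R)).

Lemma mRe_mulmx {m n p : nat} (X : 'M[R]_(m, n)) (z : 'M[R[i]]_(n, p)) :
  mRe (toC X *m z) = X *m mRe z.
Proof.
apply/matrixP => i j; rewrite !mxE (big_morph (@complex.Re R) (id1 := 0) (op1 := +%R))//; last by case=> ? ? [? ?].
by apply: eq_bigr => k _; rewrite !mxE; case: (z k j) => a b /=; rewrite mul0r subr0.
Qed.

Lemma mIm_mulmx {m n p : nat} (X : 'M[R]_(m, n)) (z : 'M[R[i]]_(n, p)) :
  mIm (toC X *m z) = X *m mIm z.
Proof.
apply/matrixP => i j; rewrite !mxE (big_morph (@complex.Im R) (id1 := 0) (op1 := +%R))//; last by case=> ? ? [? ?].
by apply: eq_bigr => k _; rewrite !mxE; case: (z k j) => a b /=; rewrite mul0r addr0.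
Qed.

(* [x + i y] is an eigenvector of [M] with eigenvalue [a + i b]. *)
Lemma real_eigenpair_in_kernel (n : nat) (M S : 'M[R]_n.+1) (v : 'cV[R]_n.+1) :
  v != 0 -> (forall k, (k < n.+1)%N -> S *m (M ^+ k *m v) = 0) ->
  exists (a b : R) (x y : 'cV[R]_n.+1), [/\ ~ (x = 0 /\ y = 0),
    M *m x = a *: x - b *: y, M *m y = b *: x + a *: y, S *m x = 0 & S *m y = 0].
Proof.
move=> v0 Sv.
have [||lam [w [w0 Mw Sw]]] :=
  @closed_field_eigenvector_in_kernel _ n (toC M) (toC S) (toC v).
- apply: contra v0 => /eqP h; apply/eqP/colP => i.
  by move/matrixP: h => /(_ i ord0); rewrite !mxE => -[].
- move=> k kn; have -> : toC M ^+ k = toC (M ^+ k) by exact: esym (rmorphXn toC k M).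
  by rewrite -!map_mxM Sv// map_mx0.
exists (complex.Re lam), (complex.Im lam), (mRe w), (mIm w); split.
- move=> [/matrixP x0 /matrixP y0]; move/eqP: w0; apply; apply/matrixP => i j.
  move: (x0 i j) (y0 i j); rewrite !mxE; case: (w i j) => a b /= -> ->//.
- rewrite -mRe_mulmx Mw; apply/matrixP => i j; rewrite !mxE.
  by case: lam {Mw} => a b; case: (w i j).
- rewrite -mIm_mulmx Mw; apply/matrixP => i j; rewrite !mxE.
  by case: lam {Mw} => a b; case: (w i j) => c d /=; rewrite addrC.
- by rewrite -mRe_mulmx Sw; apply/matrixP => i j; rewrite !mxE.
- by rewrite -mIm_mulmx Sw; apply/matrixP => i j; rewrite !mxE.
Qed.

End UnobservableEigenvector.

Section StrictLyapunov.
Context {R : realType}.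

Lemma qformDl {d : nat} (X Y : 'M[R]_d) x : qform (X + Y) x = qform X x + qform Y x.
Proof. by rewrite !qformE mulmxDl dotDr. Qed.

Lemma qformNl {d : nat} (X : 'M[R]_d) x : qform (- X) x = - qform X x.
Proof. by rewrite !qformE mulNmx dotNr. Qed.

Lemma qform_sum {d : nat} (I : finType) (F : I -> 'M[R]_d) x :
  qform (\sum_i F i) x = \sum_i qform (F i) x.
Proof.
apply: (big_morph (fun X : 'M[R]_d => qform X x)) => [X Y|]; first exact: qformDl.
by rewrite qformE mul0mx dot0r.
Qed.

Lemma qform_conj {m d : nat} (X : 'M[R]_m) (K : 'M[R]_(m, d)) x :
  qform (K^T *m X *m K) x = qform X (K *m x).
Proof. by rewrite !qformE -!mulmxA -dot_mull. Qed.

Lemma trmxX {d : nat} (M : 'M[R]_d.+1) k : (M ^+ k)^T = M^T ^+ k.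
Proof.
elim: k => [|k IH]; first by rewrite !expr0 trmx1.
by rewrite exprSr exprS -!mulmxE trmx_mul IH.
Qed.

(* [P] is only a weak Lyapunov function, but the dissipation
   [S = - (M^T P + P M)] taken along [x, M x, M^2 x, ...] sees every direction,
   so that [\sum_k (M^k)^T P M^k] is a strict one. *)
Lemma strict_lyapunov {d : nat} (M P : 'M[R]_d) :
  P^T = P -> posdef P -> neg_semidef (M^T *m P + P *m M) ->
  (forall (a b : R) (x y : 'cV[R]_d),
     M *m x = a *: x - b *: y -> M *m y = b *: x + a *: y ->
     (M^T *m P + P *m M) *m x = 0 -> (M^T *m P + P *m M) *m y = 0 ->
     x = 0 /\ y = 0) ->
  exists Q : 'M[R]_d, [/\ Q^T = Q, posdef Q & exists2 eta, 0 < eta &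
    forall x, qform (M^T *m Q + Q *m M) x <= - (eta * dot x x)].
Proof.
case: d M P => [|d] M P sP pP nS noeig.
  exists 1%:M; rewrite trmx1; split=> //; first by move=> x; rewrite (flatmx0 x) eqxx.
  by exists 1 => // x; rewrite (flatmx0 x) qformE !dot0l mulr0 oppr0.
set S := M^T *m P + P *m M in nS noeig.
have sS : S^T = S by rewrite /S linearD /= !trmx_mul trmxK sP addrC.
have psdS : psd (- S).
  by split=> [|x]; [rewrite linearN /= sS|rewrite qformNl oppr_ge0].
pose conj (X : 'M[R]_d.+1) (k : 'I_d.+1) := (M ^+ k)^T *m X *m M ^+ k.
pose Q := \sum_k conj P k; pose S1 := \sum_k conj (- S) k.
have sym X : X^T = X -> (\sum_k conj X k)^T = \sum_k conj X k.
  move=> sX; rewrite linear_sum; apply: eq_bigr => k _.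
  by rewrite /conj /= !trmx_mul trmxK sX mulmxA.
have QS : M^T *m Q + Q *m M = - S1.
  rewrite /Q mulmx_sumr mulmx_suml -big_split /= -sumrN; apply: eq_bigr => k _.
  rewrite /conj !mulmxN mulNmx opprK /S mulmxDr mulmxDl; congr (_ + _).
    rewrite !mulmxA; congr (_ *m _ *m _).
    by rewrite trmxX !mulmxE -exprS -exprSr.
  rewrite -!mulmxA; congr (_ *m (_ *m _)).
  by rewrite !mulmxE -exprS -exprSr.
(* If the form vanished at [x], then S M^k x = 0 for all k up to [d], and [M] would have an
   eigenvector in the kernel of [S]. *)
have pS1 : posdef S1.
  move=> x x0; rewrite lt_def; apply/andP; split; last first.
    by rewrite qform_sum sumr_ge0// => k _; rewrite qform_conj; exact: psdS.2.
  apply/negP => /eqP; rewrite qform_sum => /eqP.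
  rewrite psumr_eq0; last by move=> k _; rewrite qform_conj; exact: psdS.2.
  move=> /allP z; have Sx k : (k < d.+1)%N -> S *m (M ^+ k *m x) = 0.
    move=> kd; have /= := z (Ordinal kd) (mem_index_enum _).
    rewrite qform_conj => /eqP /(psd_kernel psdS) /eqP.
    by rewrite mulNmx oppr_eq0 => /eqP.
  have [a [b [u [w [uw Mu Mw Su Sw]]]]] := real_eigenpair_in_kernel x0 Sx.
  exact: uw (noeig a b u w Mu Mw Su Sw).
exists Q; split; first exact: sym.
(* The summand k = 0 is [P] itself, and the others are nonnegative. *)
- move=> x x0; rewrite qform_sum big_ord_recl ltr_wpDr//.
    apply: sumr_ge0 => k _; rewrite qform_conj.
    have [->|y0] := eqVneq (M ^+ lift ord0 k *m x) 0; first by rewrite qformE dot0l.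
    exact/ltW/pP.
  by rewrite qform_conj expr0 mul1mx; exact: pP.
- have [eta e0 H] := posdef_coercive (sym _ psdS.1) pS1.
  by exists eta => // x; rewrite QS qformNl lerN2.
Qed.

End StrictLyapunov.

(** * The network *)

Section Blocks.
Context {R : realType}.

Definition block {N n : nat} (i : 'I_N) (z : 'cV[R]_(N * n)) : 'cV[R]_n :=
  \col_j z (mxtens_index (i, j)) ord0.

Lemma sum_tens (V : nmodType) (N n : nat) (F : 'I_(N * n) -> V) :
  \sum_k F k = \sum_i \sum_j F (mxtens_index (i, j)).
Proof.
rewrite pair_big /= (reindex (fun ij : 'I_N * 'I_n => mxtens_index ij)) /=.
  by apply: eq_bigr => -[i j].
by exists (@mxtens_unindex N n) => k _; rewrite ?mxtens_indexK ?mxtens_unindexK.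
Qed.

Lemma block_tens {N N' n n' : nat} (K : 'M[R]_(N', N)) (A : 'M[R]_(n', n)) z i :
  block i ((K *t A) *m z) = \sum_l K i l *: (A *m block l z).
Proof.
apply/colP => j; rewrite !mxE sum_tens summxE; apply: eq_bigr => l _.
rewrite !mxE mulr_sumr; apply: eq_bigr => k _.
by rewrite tensmxE mxE mulrA.
Qed.

Lemma block_inj {N n : nat} (x y : 'cV[R]_(N * n)) :
  (forall i, block i x = block i y) -> x = y.
Proof.
move=> xy; apply/colP => k; case: (mxtens_indexP k) => i j.
by move/colP: (xy i) => /(_ j); rewrite !mxE.
Qed.

Lemma block0 {N n : nat} (i : 'I_N) : block i (0 : 'cV[R]_(N * n)) = 0.
Proof. by apply/colP => j; rewrite !mxE. Qed.

Lemma blockD {N n : nat} (i : 'I_N) (x y : 'cV[R]_(N * n)) :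
  block i (x + y) = block i x + block i y.
Proof. by apply/colP => j; rewrite !mxE. Qed.

Lemma blockZ {N n : nat} (i : 'I_N) a (x : 'cV[R]_(N * n)) :
  block i (a *: x) = a *: block i x.
Proof. by apply/colP => j; rewrite !mxE. Qed.

Lemma blockB {N n : nat} (i : 'I_N) (x y : 'cV[R]_(N * n)) :
  block i (x - y) = block i x - block i y.
Proof. by rewrite blockD -scaleN1r blockZ scaleN1r. Qed.

Lemma dot_block {N n : nat} (x y : 'cV[R]_(N * n)) :
  dot x y = \sum_i dot (block i x) (block i y).
Proof.
rewrite dotE sum_tens; apply: eq_bigr => i _; rewrite dotE.
by apply: eq_bigr => j _; rewrite !mxE.
Qed.

Lemma block_tens1 {N n n' : nat} (A : 'M[R]_(n', n)) (z : 'cV[R]_(N * n)) i :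
  block i ((1%:M *t A) *m z) = A *m block i z.
Proof.
rewrite block_tens (bigD1 i)//= !mxE eqxx scale1r big1 ?addr0// => l li.
by rewrite mxE eq_sym (negPf li) scale0r.
Qed.

Lemma qform_tens1 {N n : nat} (X : 'M[R]_n) (z : 'cV[R]_(N * n)) :
  qform (1%:M *t X) z = \sum_i qform X (block i z).
Proof.
rewrite qformE dot_block; apply: eq_bigr => i _.
by rewrite block_tens1 qformE.
Qed.

(** Computed blockwise, so that the final bound contains [opnorm B] rather than the norm of the
    large matrix. *)
Lemma enorm_tens1 {N n n' : nat} (A : 'M[R]_(n', n)) (z : 'cV[R]_(N * n)) :
  enorm ((1%:M *t A) *m z) <= opnorm A * enorm z.
Proof.
rewrite -(ler_pXn2r (n := 2)) ?nnegrE ?mulr_ge0 ?opnorm_ge0 ?enorm_ge0//.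
rewrite exprMn !enorm_sqr !dot_block mulr_sumr; apply: ler_sum => i _.
rewrite block_tens1 -!enorm_sqr -exprMn lerXn2r ?nnegrE ?mulr_ge0 ?opnorm_ge0 ?enorm_ge0//.
exact: enorm_mulmx_le.
Qed.

Lemma tensmxBl {m n p q : nat} (A A' : 'M[R]_(m, n)) (B : 'M[R]_(p, q)) :
  (A - A') *t B = A *t B - A' *t B.
Proof. by apply/matrixP => i j; rewrite !mxE mulrBl. Qed.

Lemma tensmxDr {m n p q : nat} (A : 'M[R]_(m, n)) (B B' : 'M[R]_(p, q)) :
  A *t (B + B') = A *t B + A *t B'.
Proof. by apply/matrixP => i j; rewrite !mxE mulrDr. Qed.

Lemma tensmx11 {m n : nat} : (1%:M : 'M[R]_m) *t (1%:M : 'M[R]_n) = 1%:M.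
Proof.
apply/matrixP => i j.
case: (mxtens_indexP i) => i0 i1; case: (mxtens_indexP j) => j0 j1.
rewrite tensmxE !mxE -natrM mulnb; congr (_ %:R); congr nat_of_bool.
by rewrite (can_eq (@mxtens_indexK m n)) xpair_eqE.
Qed.

End Blocks.

(** * Averaging projection and incidence matrix *)

Section Consensus.
Context {R : realType}.

Definition mean_mx {N : nat} : 'M[R]_N := N%:R^-1 *: (ones *m ones^T).

Section Mean.
Context {N : nat} (N0 : (0 < N)%N).
Local Notation J := (@mean_mx N).

Lemma mean_mxE i j : J i j = N%:R^-1.
Proof. by rewrite !mxE big_ord1 !mxE !mulr1. Qed.

Lemma mean_mx_tr : J^T = J.
Proof. by apply/matrixP => i j; rewrite mxE !mean_mxE. Qed.

Lemma mean_mxJ : J *m J = J.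
Proof.
apply/matrixP => i j; rewrite mxE; under eq_bigr do rewrite !mean_mxE.
rewrite sumr_const card_ord mean_mxE -[LHS]mulr_natr -mulrA mulVf ?mulr1//.
by rewrite pnatr_eq0 -lt0n.
Qed.

Lemma Pi_mxE : Pi_mx = 1%:M - J. Proof. by []. Qed.

Lemma Pi_mx_tr : (Pi_mx : 'M[R]_N)^T = Pi_mx.
Proof. by rewrite Pi_mxE linearB /= trmx1 mean_mx_tr. Qed.

Lemma Pi_mxJ : (Pi_mx : 'M[R]_N) *m J = 0.
Proof. by rewrite Pi_mxE mulmxBl mul1mx mean_mxJ subrr. Qed.

Lemma Jmx_Pi : J *m (Pi_mx : 'M[R]_N) = 0.
Proof. by rewrite Pi_mxE mulmxBr mulmx1 mean_mxJ subrr. Qed.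

Lemma Pi_mxPi : (Pi_mx : 'M[R]_N) *m Pi_mx = Pi_mx.
Proof. by rewrite {2}Pi_mxE mulmxBr mulmx1 Pi_mxJ subr0. Qed.

End Mean.

Section Incidence.
Context {N M : nat} (e : rel 'I_N) (pos neg : 'I_M -> 'I_N).
Hypotheses (e_irr : irreflexive e) (e_conn : connected_graph e)
  (hlab : edge_labelling e pos neg).
Local Notation D := (incidence_mx pos neg : 'M[R]_(N, M)).

(** Irreflexivity rules out loops, whose column in [D] would be a single +1 and would not sum to
    zero. *)
Lemma incidence_neq k : pos k != neg k.
Proof.
apply/eqP => pn; have : e (pos k) (neg k) by apply/hlab.2; exists k.
by rewrite pn e_irr.
Qed.

Lemma sum_incidence (V : lmodType R) (F : 'I_N -> V) k :
  \sum_i D i k *: F i = F (pos k) - F (neg k).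
Proof.
rewrite (bigD1 (pos k))//= (bigD1 (neg k)) 1?eq_sym ?incidence_neq//= big1 ?addr0.
  by rewrite !mxE !eqxx eq_sym (negPf (incidence_neq k)) scale1r scaleN1r.
by move=> i /andP[ip ineg]; rewrite !mxE (negPf ip) (negPf ineg) scale0r.
Qed.

Lemma mean_incidence : mean_mx *m D = 0.
Proof.
apply/matrixP => i k; rewrite mxE [RHS]mxE.
transitivity (\sum_j D j k *: (N%:R^-1 : R^o)).
  by apply: eq_bigr => j _; rewrite mean_mxE mulrC.
by rewrite sum_incidence subrr.
Qed.

Lemma Pi_incidence : Pi_mx *m D = D.
Proof. by rewrite Pi_mxE mulmxBl mul1mx mean_incidence subr0. Qed.

(** Connectivity enters the proof here, by induction along a path. *)
Lemma edgewise_constant (T : Type) (F : 'I_N -> T) :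
  (forall k, F (pos k) = F (neg k)) -> forall i j, F i = F j.
Proof.
move=> Fk i j; have /connectP[s es ->] := e_conn i j.
elim: s i es => //= l s IH i /andP[/hlab.2[k ilk] /IH <-].
(* Equality of the two end sets leaves the orientation of the edge open, hence the case split. *)
have := set21 i l; have := set22 i l; rewrite ilk !inE.
by do 2 case/orP => /eqP ->.
Qed.

End Incidence.
End Consensus.

(** * Dissipation of the network and its kernel *)

Section NetworkLyapunov.
Context {R : realType}.

Lemma hurwitz_real_eigenpair {n : nat} (A : 'M[R]_n) (a b : R) (x y : 'cV[R]_n) :
  hurwitz A -> A *m x = a *: x - b *: y -> A *m y = b *: x + a *: y ->
  ~ (x = 0 /\ y = 0) -> a < 0.
Proof.
move=> hA Ax Ay xy0.
pose z : 'cV[R[i]]_n := \col_j (x j ord0 +i* y j ord0)%C.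
suff : eigenvalue (map_mx (real_complex R) A) (a +i* b)%C by move/hA.
set AC := map_mx _ _; set lam := (a +i* b)%C.
have Az : AC *m z = lam *: z.
  have cE (u : R[i]) (v : R[i]) : complex.Re u = complex.Re v ->
      complex.Im u = complex.Im v -> u = v by case: u; case: v => ? ? ? ? /= -> ->.
  have Rz : map_mx (@complex.Re R) z = x by apply/colP => j; rewrite !mxE.
  have Iz : map_mx (@complex.Im R) z = y by apply/colP => j; rewrite !mxE.
  apply/colP => j; apply: cE.
    move: (mRe_mulmx A z); rewrite Rz Ax => /colP/(_ j); rewrite !mxE => ->.
    by [].
  move: (mIm_mulmx A z); rewrite Iz Ay => /colP/(_ j); rewrite !mxE => ->.
  by rewrite addrC.
have z0 : z != 0.
  apply/eqP => /colP z0; apply: xy0; split; apply/colP => j;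
  by move: (z0 j); rewrite !mxE => -[].
(* [eigenvalue] is about row vectors while [z] is a column; the determinant passes from right to
   left eigenvectors. *)
have : \det (AC - lam%:M) == 0.
  rewrite -det_tr; apply/det0P; exists z^T; first by rewrite trmx_eq0.
  by rewrite -trmx_mul mulmxBl mul_scalar_mx Az subrr trmx0.
case/det0P => v v0 /eqP; rewrite mulmxBr mul_mx_scalar subr_eq0 => /eqP Av.
by apply/eigenvalueP; exists v.
Qed.

Context {N M n p : nat} (N0 : (0 < N)%N) (e : rel 'I_N) (pos neg : 'I_M -> 'I_N).
Hypotheses (e_irr : irreflexive e) (e_conn : connected_graph e)
  (hlab : edge_labelling e pos neg).
Local Notation D := (incidence_mx pos neg : 'M[R]_(N, M)).
Variables (A : 'M[R]_n) (B : 'M[R]_(n, p)) (C : 'M[R]_(p, n)).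
Local Notation At := (A_tilde D A B C).
Local Notation J := (mean_mx *t (1%:M : 'M[R]_n) : 'M[R]_(N * n)).
Local Notation Pi := (disagreement_mx : 'M[R]_(N * n)).

Lemma A_tildeE : At = 1%:M *t A - (D *m D^T) *t (B *m C).
Proof. by rewrite /A_tilde !tensmx_mul !mul1mx !mulmx1. Qed.

Lemma disagreementE : Pi = 1%:M - J.
Proof. by rewrite /disagreement_mx Pi_mxE tensmxBl tensmx11. Qed.

Lemma disagreement_tr : Pi^T = Pi.
Proof. by rewrite /disagreement_mx trmx_tens trmx1 Pi_mx_tr. Qed.

Lemma disagreement_idem : Pi *m Pi = Pi.
Proof. by rewrite /disagreement_mx tensmx_mul mulmx1 Pi_mxPi. Qed.

Lemma mean_disagreement : J *m Pi = 0.
Proof. by rewrite /disagreement_mx tensmx_mul mulmx1 Jmx_Pi// tens0mx. Qed.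

Lemma disagreement_A_tilde : Pi *m At = At *m Pi.
Proof.
have PD : Pi_mx *m (D *m D^T) = D *m D^T by rewrite mulmxA (Pi_incidence e_irr hlab).
have DP : (D *m D^T) *m Pi_mx = D *m D^T.
  by apply: trmx_inj; rewrite trmx_mul Pi_mx_tr trmx_mul trmxK.
rewrite A_tildeE /disagreement_mx mulmxBr mulmxBl !tensmx_mul PD DP.
by rewrite !mulmx1 !mul1mx.
Qed.

Variable P : 'M[R]_n.
Hypotheses (sP : P = P^T) (pP : posdef P) (nP : neg_semidef (A^T *m P + P *m A))
  (hBP : B^T *m P = C) (hdet : detectable C A).
Local Notation PN := (1%:M *t P : 'M[R]_(N * n)).
Local Notation Mn := (At - J).

(** Passivity at work: P B = C^T turns the coupling into the square of [D^T *t C], and idempotence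
    of [J] turns the subtracted projection into another square. All three summands are thus negative
    semidefinite. *)
Lemma dissipationE : Mn^T *m PN + PN *m Mn =
  1%:M *t (A^T *m P + P *m A) - 2 *: ((D^T *t C)^T *m (D^T *t C))
  - 2 *: (J^T *m PN *m J).
Proof.
have PB : P *m B = C^T by rewrite -hBP trmx_mul trmxK -sP.
rewrite A_tildeE !linearB /= !trmx_tens !trmx1 !trmx_mul !trmxK mean_mx_tr.
rewrite !mulmxBl ?mulmxBr !tensmx_mul !mul1mx !mulmx1 mean_mxJ//.
rewrite (mulmxA P B) PB -(mulmxA C^T) hBP tensmxDr.
set a := _ *t (_ *m P); set b := _ *t (P *m A); set c := _ *t (C^T *m C).
set d := _ *t P; clearbody a b c d.
by apply/matrixP => i j; rewrite !mxE; ring.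
Qed.

Lemma qform_PN_ge0 z : 0 <= qform PN z.
Proof.
rewrite qform_tens1 sumr_ge0// => i _.
have [->|x0] := eqVneq (block i z) 0; first by rewrite qformE dot0l.
exact/ltW/pP.
Qed.

Lemma posdef_PN : posdef PN.
Proof.
move=> z z0; rewrite lt_def qform_PN_ge0 andbT; apply: contra z0 => /eqP.
rewrite qform_tens1 => /eqP; rewrite psumr_eq0; last first.
  move=> i _; have [->|x0] := eqVneq (block i z) 0; first by rewrite qformE dot0l.
  exact/ltW/pP.
move=> /allP zi; apply/eqP/block_inj => i; rewrite block0; apply/eqP/negPn/negP.
by move=> /pP; have /= /eqP -> := zi i (mem_index_enum i); rewrite ltxx.
Qed.

Lemma qformZl {d : nat} (X : 'M[R]_d) a x : qform (a *: X) x = a * qform X x.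
Proof. by rewrite !qformE -scalemxAl dotZr. Qed.

Lemma qform_dissipation z : qform (Mn^T *m PN + PN *m Mn) z =
  \sum_i qform (A^T *m P + P *m A) (block i z)
  - 2 * enorm ((D^T *t C) *m z) ^+ 2 - 2 * qform PN (J *m z).
Proof.
rewrite dissipationE !qformDl !qformNl !qformZl qform_tens1 qform_conj.
by rewrite qformE -mulmxA dot_mulr trmxK -enorm_sqr.
Qed.

Lemma dissipation_le0 : neg_semidef (Mn^T *m PN + PN *m Mn).
Proof.
move=> z; rewrite qform_dissipation.
have : \sum_i qform (A^T *m P + P *m A) (block i z) <= 0 by apply: sumr_le0.
have := sqr_ge0 (enorm ((D^T *t C) *m z)); have := qform_PN_ge0 (J *m z); lra.
Qed.

(** Each of the three summands must vanish. The second makes the outputs agree along edges; the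
    third makes the average state zero, so the common output is zero. Coupling and [J] then drop out
    of [Mn *m z]. *)
Lemma dissipation_kernel z : (Mn^T *m PN + PN *m Mn) *m z = 0 ->
  [/\ forall i, C *m block i z = 0 & forall i, block i (Mn *m z) = A *m block i z].
Proof.
move=> /(congr1 (dot z)); rewrite -qformE dot0r qform_dissipation => z0.
have h1 : \sum_i qform (A^T *m P + P *m A) (block i z) <= 0 by apply: sumr_le0.
have h2 := sqr_ge0 (enorm ((D^T *t C) *m z)); have h3 := qform_PN_ge0 (J *m z).
have Dz : (D^T *t C) *m z = 0.
  by apply: enorm_eq0; apply/eqP; rewrite -sqrf_eq0; apply/eqP; lra.
have Jz : J *m z = 0.
  apply/eqP/negPn/negP => /posdef_PN; have : qform PN (J *m z) = 0 by lra.
  by move=> ->; rewrite ltxx.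
have Ce k : C *m block (pos k) z = C *m block (neg k) z.
  apply/eqP; rewrite -subr_eq0 -(sum_incidence e_irr hlab (fun i => C *m block i z)).
  apply/eqP; rewrite -[RHS](block0 k) -Dz block_tens.
  by apply: eq_bigr => i _; rewrite [in RHS]mxE.
have Cc := edgewise_constant e_conn hlab (F := fun i => C *m block i z) Ce.
have Nn0 : (N%:R : R) != 0 by rewrite pnatr_eq0 -lt0n.
split=> i.
  have : C *m block i (J *m z) = 0 by rewrite Jz block0 mulmx0.
  rewrite block_tens mulmx_sumr (eq_bigr (fun=> N%:R^-1 *: (C *m block i z))).
    rewrite sumr_const card_ord -scaler_nat scalerA divff// scale1r//.
  by move=> l _; rewrite mean_mxE mul1mx -scalemxAr (Cc l i).
rewrite A_tildeE 2!mulmxBl Jz subr0 -tensmx_mul -mulmxA Dz mulmx0 subr0.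
exact: block_tens1.
Qed.

Lemma network_strict_lyapunov :
  exists Q : 'M[R]_(N * n), [/\ Q^T = Q, posdef Q & exists2 eta, 0 < eta &
    forall x, J *m x = 0 -> 2 * dot x (Q *m (At *m x)) <= - (eta * dot x x)].
Proof.
have sPN : PN^T = PN by rewrite trmx_tens trmx1 -sP.
have [|Q [sQ pQ [eta eta0 H]]] := strict_lyapunov sPN posdef_PN dissipation_le0.
  move=> a b x y Mx My Sx Sy.
  have [Cx Ax] := dissipation_kernel Sx; have [Cy Ay] := dissipation_kernel Sy.
  have [L hL] := hdet.
  (* Since the outputs vanish, [A - L *m C] acts on each block as [A] does and inherits the
     eigenpair. *)
  have a_lt0 i : ~ (block i x = 0 /\ block i y = 0) -> a < 0.
    apply: (hurwitz_real_eigenpair (b := b) hL).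
      by rewrite mulmxBl -mulmxA Cx mulmx0 subr0 -Ax Mx blockB !blockZ.
    by rewrite mulmxBl -mulmxA Cy mulmx0 subr0 -Ay My blockD !blockZ.
  (* Summed over [x] and [y], the cross terms in [b] cancel and [a] times the total energy is left
     equal to zero. *)
  have energy z : (Mn^T *m PN + PN *m Mn) *m z = 0 -> dot z (PN *m (Mn *m z)) = 0.
    move=> /(congr1 (dot z)); rewrite dot0r mulmxDl dotDr -!mulmxA.
    by rewrite dot_mulr trmxK dotC dot_mull sPN => h; lra.
  have := energy x Sx; have := energy y Sy; rewrite Mx My !mulmxDr mulmxN !dotDr dotNr -!scalemxAr !dotZr.
  have -> : dot y (PN *m x) = dot x (PN *m y) by rewrite dotC dot_mull sPN.
  rewrite -!qformE => ey ex.
  have ea : a * (qform PN x + qform PN y) = 0 by lra.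
  have x0 := qform_PN_ge0 x; have y0 := qform_PN_ge0 y.
  have zero z : qform PN z = 0 -> z = 0.
    by move=> z0; apply/eqP/negPn/negP => /posdef_PN; rewrite z0 ltxx.
  move/eqP: ea; rewrite mulf_eq0 => /orP[/eqP a0|/eqP s0]; last first.
    by split; apply: zero; lra.
  split; apply: block_inj => i; rewrite block0; apply/eqP/negPn/negP => h.
    by have : a < 0 by [apply: (a_lt0 i) => -[h1]; rewrite h1 eqxx in h]; rewrite a0 ltxx.
  by have : a < 0 by [apply: (a_lt0 i) => -[_ h1]; rewrite h1 eqxx in h]; rewrite a0 ltxx.
exists Q; split=> //; exists eta => // x Jx.
have := H x; rewrite qformE mulmxDl dotDr -!mulmxA dot_mulr trmxK.
have -> : Mn *m x = At *m x by rewrite mulmxBl Jx subr0.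
have -> : dot (At *m x) (Q *m x) = dot x (Q *m (At *m x)) by rewrite dotC dot_mull sQ.
by move=> h; lra.
Qed.

End NetworkLyapunov.

(** * Matrix exponential and the Gramian *)

Section MatrixExponential.
Context {R : realType} {d : nat}.
Implicit Types X : 'M[R]_d.

(* Entry [(i, j)] of the exponential series of [X], differentiated [m] times. *)
Definition expmx_coeff X (i j : 'I_d) (m k : nat) : R :=
  (k`!%:R)^-1 * (X ^+ (k + m)) i j.

Lemma mx_exp_entry_le X :
  exists2 c, 0 <= c & forall k i j, `|(X ^+ k) i j| <= c ^+ k.
Proof.
pose c := \sum_i \sum_j `|X i j|.
have c0 : 0 <= c by apply: sumr_ge0 => i _; apply: sumr_ge0.
exists c => // k i j.
elim: k i j => [|k IH] i j.
  by rewrite !expr0 !mxE; case: eqP; rewrite ?normr1 ?normr0.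
rewrite !exprS -mulmxE mxE (le_trans (ler_norm_sum _ _ _))//.
have Xc : \sum_l `|X i l| <= c.
  by rewrite /c [leRHS](bigD1 i)//= lerDl; apply: sumr_ge0 => ? _; apply: sumr_ge0.
rewrite (le_trans _ (ler_wpM2r (exprn_ge0 k c0) Xc))// mulr_suml ler_sum// => l _.
by rewrite normrM ler_wpM2l.
Qed.

Lemma is_cvg_expmx_coeff X i j m (s : R) : cvgn (pseries (expmx_coeff X i j m) s).
Proof.
have [c c0 Xc] := mx_exp_entry_le X.
apply: normed_cvg; apply: (@series_le_cvg _ _ (fun k => c ^+ m * exp_coeff (c * `|s|) k)).
- by move=> k; exact: normr_ge0.
- move=> k; rewrite /exp_coeff /= mulr_ge0 ?exprn_ge0// divr_ge0// exprn_ge0// mulr_ge0//.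
- move=> k; rewrite /expmx_coeff /exp_coeff /= !normrM normfV normr_nat normrX.
  have -> : c ^+ m * ((c * `|s|) ^+ k / k`!%:R) = k`!%:R^-1 * c ^+ (k + m) * `|s| ^+ k.
    by rewrite exprMn exprD; ring.
  by rewrite ler_wpM2r ?exprn_ge0// ler_wpM2l.
apply: is_cvg_seriesZ; exact: is_cvg_series_exp_coeff.
Qed.

Definition expmx_series X i j m (s : R) : R := limn (pseries (expmx_coeff X i j m) s).

Lemma scaled_mx_exp X (s : R) k : (s *: X) ^+ k = s ^+ k *: X ^+ k.
Proof.
elim: k => [|k IH]; first by rewrite !expr0 scale1r.
by rewrite !exprS IH -!mulmxE -scalemxAl -scalemxAr scalerA.
Qed.

(** Reduces the limit of matrices to scalar power series in [s], which can be differentiated term by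
    term. *)
Lemma expmxE X (s : R) i j : expmx (s *: X) i j = expmx_series X i j 0 s.
Proof.
suff : series (fun k : nat => (k`!%:R)^-1 *: (s *: X) ^+ k) @ \oo -->
    \matrix_(i, j) expmx_series X i j 0 s.
  by move/cvg_lim => h; rewrite /expmx h// mxE.
apply/cvgrPdist_le => /= eps eps0; near=> k.
rewrite [leLHS]/Num.Def.normr/= mx_normrE (bigmax_le _ (ltW eps0))//= => -[i0 j0] _.
rewrite !mxE /=.
move: i0 j0; near: k; apply: filter_forall => i1; apply: filter_forall => j1.
have /cvgrPdist_le/(_ _ eps0) := @is_cvg_expmx_coeff X i1 j1 0 s.
apply: filterS => k; rewrite /pseries /series /= summxE => h.
rewrite (le_trans _ h)// le_eqVlt; apply/orP; left; apply/eqP.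
congr `|_ - _|; apply: eq_bigr => l _.
by rewrite /expmx_coeff scaled_mx_exp !mxE addn0; ring.
Unshelve. all: by end_near. Qed.

(** Differentiation shifts the coefficients because (k+1) / (k+1)! = 1 / k!; any radius beyond |s|
    will do, as the series converges everywhere. *)
Lemma is_derive_expmx_series X i j m (s : R) :
  is_derive s 1 (expmx_series X i j m) (expmx_series X i j m.+1 s).
Proof.
have diffs l : pseries_diffs (expmx_coeff X i j l) = expmx_coeff X i j l.+1.
  apply/funext => k; rewrite /pseries_diffs /expmx_coeff addSnnS mulrA; congr (_ * _).
  by rewrite factS natrM invfM mulrA divff ?mul1r// pnatr_eq0.
rewrite /expmx_series -diffs.
apply: (@pseries_snd_diffs _ _ (`|s| + 1)); rewrite ?diffs; try exact: is_cvg_expmx_coeff.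
by rewrite [X in _ < X]ger0_norm ?addr_ge0// ltrDl.
Qed.

Lemma expmx_seriesSl X i j (s : R) :
  expmx_series X i j 1 s = \sum_l X i l * expmx_series X l j 0 s.
Proof.
apply/cvg_lim => //.
have -> : pseries (expmx_coeff X i j 1) s =
    fun n => \sum_l X i l * pseries (expmx_coeff X l j 0) s n.
  apply/funext => n; rewrite /pseries /series /=.
  under [RHS]eq_bigr do rewrite mulr_sumr; rewrite exchange_big /=.
  apply: eq_bigr => k _; rewrite /expmx_coeff addn0 addn1 exprS -mulmxE mxE.
  rewrite mulr_sumr mulr_suml; apply: eq_bigr => l _; ring.
apply: cvg_big => [|l _]; first exact: add_continuous.
 apply: cvgMl_tmp; exact: is_cvg_expmx_coeff.
Qed.

(** Both products are limits of the same partial sums, since [Y] commutes with every power of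
    [X]. *)
Lemma expmx_comm X Y (s : R) :
  X *m Y = Y *m X -> Y *m expmx (s *: X) = expmx (s *: X) *m Y.
Proof.
move=> XY.
have XkY k : (X ^+ k) *m Y = Y *m X ^+ k.
  elim: k => [|k IH]; first by rewrite !expr0 mul1mx mulmx1.
  by rewrite !exprS -!mulmxE -mulmxA IH !mulmxA XY.
apply/matrixP => i j; rewrite !mxE.
under eq_bigr do rewrite expmxE; under [RHS]eq_bigr do rewrite expmxE.
have h1 : (fun n => \sum_l Y i l * pseries (expmx_coeff X l j 0) s n) @ \oo -->
    \sum_l Y i l * expmx_series X l j 0 s.
  apply: cvg_big => [|l _]; first exact: add_continuous.
  by apply: cvgMl_tmp; exact: is_cvg_expmx_coeff.
rewrite -(cvg_lim _ h1)//; apply/cvg_lim => //.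
have -> : (fun n => \sum_l Y i l * pseries (expmx_coeff X l j 0) s n) =
    fun n => \sum_l pseries (expmx_coeff X i l 0) s n * Y l j.
  apply/funext => n; rewrite /pseries /series /=.
  under eq_bigr do rewrite mulr_sumr; under [RHS]eq_bigr do rewrite mulr_suml.
  rewrite exchange_big [RHS]exchange_big /=; apply: eq_bigr => k _.
  have /matrixP/(_ i j) := XkY (k + 0)%N; rewrite !mxE /expmx_coeff => h.
  transitivity (k`!%:R^-1 * s ^+ k * \sum_l Y i l * (X ^+ (k + 0)) l j).
    by rewrite mulr_sumr; apply: eq_bigr => l _; ring.
  by rewrite -h mulr_sumr; apply: eq_bigr => l _; ring.
apply: cvg_big => [|l _]; first exact: add_continuous.
by apply: cvgMr_tmp; exact: is_cvg_expmx_coeff.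
Qed.

Lemma expmx0 X : expmx (0 *: X) = 1%:M.
Proof.
apply/matrixP => i j; rewrite expmxE mxE; apply/cvg_lim => //.
(* The partial sum of index 0 is empty, so the sequence is constant only from index 1 on. *)
rewrite -(cvg_shiftS _); apply: cvg_near_cst; near=> n.
rewrite /pseries /series /= big_nat_recl//= big1 ?addr0; last first.
  by move=> k _; rewrite expr0n mulr0.
by rewrite /expmx_coeff addn0 !expr0 fact0 invr1 mul1r mulr1 mxE.
Unshelve. all: by end_near. Qed.

Lemma expmx_tr X (s : R) : expmx (s *: X^T) = (expmx (s *: X))^T.
Proof.
have h k : (X^T) ^+ k = (X ^+ k)^T.
  elim: k => [|k IH]; first by rewrite !expr0 trmx1.
  by rewrite exprS exprSr -!mulmxE trmx_mul IH.
apply/matrixP => i j; rewrite mxE !expmxE /expmx_series; congr (limn (pseries _ _)).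
by apply/funext => k; rewrite /expmx_coeff h mxE.
Qed.

End MatrixExponential.

(** * Entrywise calculus of matrix functions *)

Section MatrixDerivative.
Context {R : realType}.

(** Entrywise, so that the product rule for [*m] reduces to the scalar one; [is_derive_mx]
    identifies it with [is_derive]. *)
Definition is_mx_derive {m n : nat} (t : R) (F : R -> 'M[R]_(m, n)) (dF : 'M[R]_(m, n)) :=
  forall i j, is_derive t (1 : R) (fun s => F s i j) (dF i j).

Lemma is_mx_derive_expmx {d : nat} (X : 'M[R]_d) t :
  is_mx_derive t (fun s => expmx (s *: X)) (X *m expmx (t *: X)).
Proof.
move=> i j; rewrite mxE; under eq_bigr do rewrite expmxE.
rewrite -expmx_seriesSl.
have -> : (fun s => expmx (s *: X) i j) = expmx_series X i j 0.
  by apply/funext => s; rewrite expmxE.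
exact: is_derive_expmx_series.
Qed.

Lemma is_mx_derive_cst {m n : nat} (t : R) (K : 'M[R]_(m, n)) :
  is_mx_derive t (fun=> K) 0.
Proof. by move=> i j; rewrite mxE; exact: is_derive_cst. Qed.

Lemma is_mx_derive_mul {m n p : nat} (t : R) (F : R -> 'M[R]_(m, n))
    (G : R -> 'M[R]_(n, p)) dF dG :
  is_mx_derive t F dF -> is_mx_derive t G dG ->
  is_mx_derive t (fun s => F s *m G s) (dF *m G t + F t *m dG).
Proof.
move=> hF hG i j; rewrite !mxE -big_split /=.
have -> : (fun s => (F s *m G s) i j) =
    \sum_(k < n) ((fun s => F s i k) * (fun s => G s k j)).
  by apply/funext => s; rewrite mxE fct_sumE.
apply: is_derive_sum => k.
apply: is_derive_eq (is_deriveM (hF i k) (hG k j)) _.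
by rewrite /= addrC; congr (_ + _); rewrite mulrC.
Qed.

Lemma is_mx_derive_mull {m n p : nat} (t : R) (K : 'M[R]_(m, n))
    (G : R -> 'M[R]_(n, p)) dG :
  is_mx_derive t G dG -> is_mx_derive t (fun s => K *m G s) (K *m dG).
Proof.
by move=> /(is_mx_derive_mul (is_mx_derive_cst t K)); rewrite mul0mx add0r.
Qed.

Lemma is_mx_derive_mulr {m n p : nat} (t : R) (F : R -> 'M[R]_(m, n))
    (K : 'M[R]_(n, p)) dF :
  is_mx_derive t F dF -> is_mx_derive t (fun s => F s *m K) (dF *m K).
Proof.
by move=> /is_mx_derive_mul/(_ (is_mx_derive_cst t K)); rewrite mulmx0 addr0.
Qed.

Lemma is_mx_derive_add {m n : nat} (t : R) (F G : R -> 'M[R]_(m, n)) dF dG :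
  is_mx_derive t F dF -> is_mx_derive t G dG ->
  is_mx_derive t (fun s => F s + G s) (dF + dG).
Proof.
move=> hF hG i j; rewrite mxE.
have -> : (fun s => (F s + G s) i j) = (fun s => F s i j) + (fun s => G s i j).
  by apply/funext => s; rewrite mxE.
exact: is_deriveD (hF i j) (hG i j).
Qed.

Lemma is_mx_derive_sub {m n : nat} (t : R) (F G : R -> 'M[R]_(m, n)) dF dG :
  is_mx_derive t F dF -> is_mx_derive t G dG ->
  is_mx_derive t (fun s => F s - G s) (dF - dG).
Proof.
move=> hF hG i j; rewrite !mxE.
have -> : (fun s => (F s - G s) i j) = (fun s => F s i j) - (fun s => G s i j).
  by apply/funext => s; rewrite !mxE.
exact: is_deriveB (hF i j) (hG i j).
Qed.

Lemma is_mx_derive_tr {m n : nat} (t : R) (F : R -> 'M[R]_(m, n)) dF :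
  is_mx_derive t F dF -> is_mx_derive t (fun s => (F s)^T) dF^T.
Proof.
move=> hF i j; rewrite mxE.
have -> : (fun s => (F s)^T i j) = (fun s => F s j i) by apply/funext => s; rewrite mxE.
exact: hF.
Qed.

Lemma is_mx_derive_dot {d : nat} (t : R) (f g : R -> 'cV[R]_d) df dg :
  is_mx_derive t f df -> is_mx_derive t g dg ->
  is_derive t 1 (fun s => dot (f s) (g s)) (dot df (g t) + dot (f t) dg).
Proof.
move=> hf hg; have := is_mx_derive_mul (is_mx_derive_tr hf) hg ord0 ord0.
by rewrite mxE.
Qed.

Lemma is_mx_derive_qform {d : nat} (t : R) (Q : 'M[R]_d) (f : R -> 'cV[R]_d) df :
  Q^T = Q -> is_mx_derive t f df ->
  is_derive t 1 (fun s => qform Q (f s)) (2 * dot (f t) (Q *m df)).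
Proof.
move=> sQ hf; have := is_mx_derive_dot hf (is_mx_derive_mull Q hf).
have -> : (fun s => dot (f s) (Q *m f s)) = (fun s => qform Q (f s)).
  by apply/funext => s; rewrite qformE.
by move=> h; apply: is_derive_eq h _; rewrite dotC dot_mull sQ; ring.
Qed.

Lemma is_derive_mx {m n : nat} (t : R) (F : R -> 'M[R]_(m, n)) dF :
  is_derive t 1 F dF <-> is_mx_derive t F dF.
Proof.
split=> [[Fd <-] i j|h].
  have /derivable_mxP Fij := Fd; rewrite derive_mx// mxE; exact: derivableP.
have Fd : derivable F t 1 by apply/derivable_mxP => i j; case: (h i j).
apply: DeriveDef => //; rewrite derive_mx//; apply/matrixP => i j; rewrite mxE.
by case: (h i j).
Qed.

End MatrixDerivative.

(** * Improper integrals of exponentially bounded functions *)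

Section ExponentialIntegrals.
Context {R : realType}.
Notation mu := (@lebesgue_measure R).

Lemma derivable_continuous (f df : R -> R) :
  (forall x : R, is_derive x 1 f (df x)) -> continuous f.
Proof.
move=> fd x; apply/differentiable_continuous/derivable1_diffP.
by case: (fd x).
Qed.

Lemma is_derive_expRM (a x : R) :
  is_derive x 1 (fun s => expR (a * s)) (a * expR (a * x)).
Proof.
have h : is_derive x 1 (fun s : R => a * s) a.
  by apply: is_derive_eq (is_deriveZ a (is_derive_id x 1)) _; rewrite /= [_ *: _]mulr1.
have := @is_derive1_comp R expR (fun s => a * s) x _ _ (is_derive_expR _) h.
by rewrite mulrC.
Qed.

Lemma integrable_expR_decay (eps : R) : 0 < eps ->
  mu.-integrable `[0, +oo[ (EFin \o (fun s => expR (- eps * s))).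
Proof.
move=> e0; have := integrable_exponential_pdf e0.
move=> /(@integrableS _ _ _ mu setT `[0, +oo[ _ measurableT (measurable_itv _) (@subsetT _ _)).
move=> /(@integrableZl _ _ _ mu _ (measurable_itv _) eps^-1).
apply: eq_integrable => // x; rewrite inE /= in_itv /= andbT => x0.
by rewrite exponential_pdfE//= -EFinM mulrA mulVf ?mul1r// gt_eqF.
Qed.

(** Integrability travels with the value because linearity of the integral depends on it. *)
Definition has_Rint (f : R -> R) (v : R) :=
  mu.-integrable `[0, +oo[ (EFin \o f) /\ \int[mu]_(s in `[0, +oo[) f s = v.

Lemma has_RintD f g u v : has_Rint f u -> has_Rint g v ->
  has_Rint (fun s => f s + g s) (u + v).
Proof.
move=> [fi <-] [gi <-]; split; last by rewrite RintegralD.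
exact: (@integrableD _ _ _ mu _ (measurable_itv _) _ _ fi gi).
Qed.

Lemma has_RintZ a f u : has_Rint f u -> has_Rint (fun s => a * f s) (a * u).
Proof.
move=> [fi <-]; split; last by rewrite RintegralZl.
exact: (@integrableZl _ _ _ mu _ (measurable_itv _) a _ fi).
Qed.

Lemma has_Rint_sum (I : finType) (F : I -> R -> R) (u : I -> R) :
  (forall i, has_Rint (F i) (u i)) ->
  has_Rint (fun s => \sum_i F i s) (\sum_i u i).
Proof.
move=> Fu; have h0 : has_Rint (fun=> 0) 0.
  split; last by rewrite /Rintegral /= integral0.
  exact: (@integrable0 _ _ _ mu).
elim: (index_enum I) => [|i r IH].
  by rewrite big_nil; under eq_fun do rewrite big_nil.
by rewrite big_cons; under eq_fun do rewrite big_cons; exact: has_RintD.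
Qed.

Lemma expR_decay_cvg0 (eps : R) : 0 < eps -> expR (- eps * s) @[s --> +oo] --> (0 : R).
Proof.
move=> e0; apply/cvgrPdist_le => /= d d0; near=> s.
rewrite sub0r normrN ger0_norm ?expR_ge0//.
rewrite mulNr expRN invf_ple ?posrE ?expR_gt0//.
rewrite (le_trans _ (expR_ge1Dx _))// -lerBlDl.
by rewrite -ler_pdivrMl.
Unshelve. all: by end_near. Qed.

Lemma integrable_expR_bound (f : R -> R) (K eps : R) : 0 < eps -> continuous f ->
  (forall s : R, 0 <= s -> `|f s| <= K * expR (- eps * s)) ->
  mu.-integrable `[0, +oo[ (EFin \o f).
Proof.
move=> e0 cf fK.
have := @integrableZl _ _ _ mu _ (measurable_itv _) K _ (integrable_expR_decay e0).
apply: le_integrable => //.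
  by apply/measurable_EFinP/measurable_funTS; exact: continuous_measurable_fun.
move=> x; rewrite /= in_itv /= andbT => x0.
by rewrite lee_fin (le_trans (fK x x0))// ler_norm.
Qed.

(** The primitive [F] tends to zero at infinity by its exponential bound, so only its value at 0
    survives. *)
Lemma Rint_derivative_expR_decay (F f df : R -> R) (K eps : R) : 0 < eps ->
  (forall x : R, is_derive x 1 F (f x)) -> (forall x : R, is_derive x 1 f (df x)) ->
  (forall s : R, 0 <= s -> `|f s| <= K * expR (- eps * s)) ->
  (forall s : R, 0 <= s -> `|F s| <= K * expR (- eps * s)) ->
  has_Rint f (- F 0).
Proof.
move=> e0 Ff fd fK FK.
have cf := derivable_continuous fd; have cF := derivable_continuous Ff.
have fi := integrable_expR_bound e0 cf fK.
split=> //.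
(* [K e^(- eps s)] is added because the improper fundamental theorem of calculus
   is stated for nonnegative integrands. *)
pose g s := f s + K * expR (- eps * s).
pose G s := F s - K / eps * expR (- eps * s).
have Gg (x : R) : is_derive x 1 G (g x).
  apply: is_derive_eq (is_deriveB (Ff x) (is_deriveZ (K / eps) (is_derive_expRM (- eps) x))) _.
  rewrite /g; congr (_ + _); rewrite -scalerN /= -[_ *: _]/(_ * _) mulNr opprK mulrA.
  by rewrite divfK// gt_eqF.
have cg : continuous g.
  exact: derivable_continuous (fun x => is_deriveD (fd x)
    (is_deriveZ K (is_derive_expRM (- eps) x))).
have Fl : F s @[s --> +oo] --> (0 : R).
  apply/cvgrPdist_le => /= d d0; near=> s; rewrite sub0r normrN.
  rewrite (le_trans (FK s _))//; near: s.
  have : K * expR (- eps * s) @[s --> +oo] --> K * 0.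
    by apply: cvgMl_tmp; exact: expR_decay_cvg0.
  rewrite mulr0 => /cvgrPdist_le/(_ d d0); apply: filterS => s.
  by rewrite sub0r normrN; apply: le_trans; exact: ler_norm.
have Gl : G s @[s --> +oo] --> (0 : R).
  rewrite -(subr0 0); apply: cvgB => //; rewrite -(mulr0 (K / eps)).
  by apply: cvgMl_tmp; exact: expR_decay_cvg0.
have ig : \int[mu]_(s in `[0, +oo[) g s = 0 - G 0.
  apply: Rintegral_ge0_continuous_FTC2y Gl _ _ _.
  - move=> x x0; have := fK x x0; rewrite ler_norml => /andP[h _].
    by rewrite /g; lra.
  - exact: continuous_subspaceT.
  - by move=> x _; case: (Gg x).
  - apply: cvg_at_right_filter; exact: (derivable_continuous Gg).
  - by move=> x _; rewrite derive1E; case: (Gg x).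
(* The integral of the term added to [f], to be subtracted again. *)
have ie : has_Rint (fun s => expR (- eps * s)) eps^-1.
  split; first exact: integrable_expR_decay.
  pose H s := - eps^-1 * expR (- eps * s).
  have He (x : R) : is_derive x 1 H (expR (- eps * x)).
    apply: is_derive_eq (is_deriveZ (- eps^-1) (is_derive_expRM (- eps) x)) _.
    by rewrite -[_ *: _]/(_ * _) mulrA mulrNN mulVf ?mul1r// gt_eqF.
  have -> : eps^-1 = 0 - H 0 by rewrite /H mulr0 expR0 mulr1 sub0r opprK.
  apply: Rintegral_ge0_continuous_FTC2y.
  - by move=> x _; exact: expR_ge0.
  - by apply: continuous_subspaceT; exact: derivable_continuous (is_derive_expRM _).
  - by rewrite -(mulr0 (- eps^-1)); apply: cvgMl_tmp; exact: expR_decay_cvg0.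
  - by move=> x _; case: (He x).
  - apply: cvg_at_right_filter; exact: (derivable_continuous He).
  - by move=> x _; rewrite derive1E; case: (He x).
have hg : has_Rint g (0 - G 0).
  split=> //.
  exact: (@integrableD _ _ _ mu _ (measurable_itv _) _ _ fi
    (@integrableZl _ _ _ mu _ (measurable_itv _) K _ (integrable_expR_decay e0))).
have := has_RintD hg (has_RintZ (- K) ie).
have -> : (fun s => g s + - K * expR (- eps * s)) = f.
  by apply/funext => s; rewrite /g; ring.
have -> : 0 - G 0 + - K / eps = - F 0.
  by rewrite /G mulr0 expR0 mulr1; ring.
by case.
Unshelve. all: by end_near. Qed.

End ExponentialIntegrals.

(** * Lyapunov equation of the projected Gramian *)

Section GramianLyapunov.
Context {R : realType} {d : nat}.
Variables (X Pi Q : 'M[R]_d) (eta : R).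
Hypotheses (sPi : Pi^T = Pi) (PiPi : Pi *m Pi = Pi) (PiX : Pi *m X = X *m Pi)
  (sQ : Q^T = Q) (pQ : posdef Q) (eta0 : 0 < eta)
  (hQ : forall x, Pi *m x = x -> 2 * dot x (Q *m (X *m x)) <= - (eta * dot x x)).

Let Phi (s : R) := expmx (s *: X) *m Pi.

(** [Pi] commutes with the flow, so trajectories stay in its range, where [hQ] makes [Q] decrease at
    the rate [eta / K]. *)
Lemma projected_flow_decay : exists2 eps, 0 < eps &
  exists2 K, 0 <= K & forall w s, 0 <= s ->
    dot (Phi s *m w) (Phi s *m w) <= K * dot w w * expR (- eps * s).
Proof.
have [q q0 Qq] := posdef_coercive sQ pQ.
have [K0 K00 QK0] := enorm_mulmx_bounded Q.
pose K := K0 + 1; have K_gt0 : 0 < K by rewrite ltr_wpDl.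
have QK x : qform Q x <= K * dot x x.
  rewrite qformE (le_trans (dot_le_enorm _ _))// -enorm_sqr.
  have := QK0 x; have := enorm_ge0 x; rewrite /K.
  set a := enorm x; set b := enorm _ => a0 bK; nra.
have [L L0 PiL] := enorm_mulmx_bounded Pi.
exists (eta / K); first exact: divr_gt0.
exists (K * L ^+ 2 / q).
  by rewrite divr_ge0 ?mulr_ge0 ?sqr_ge0// ltW.
move=> w s s0.
pose f t := Phi t *m w.
have fd t : is_mx_derive t f (X *m f t).
  rewrite /f /Phi !mulmxA; do 2 apply: is_mx_derive_mulr.
  exact: is_mx_derive_expmx.
have Pif t : Pi *m f t = f t.
  by rewrite /f /Phi !mulmxA (expmx_comm _ (esym PiX)) -[_ *m Pi *m Pi]mulmxA PiPi.
(* The integrating factor turns exponential decay into monotonicity. *)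
pose g t := expR (eta / K * t) * qform Q (f t).
pose dg t := expR (eta / K * t) * (eta / K * qform Q (f t) + 2 * dot (f t) (Q *m (X *m f t))).
have gd (t : R) : is_derive t 1 g (dg t).
  apply: is_derive_eq (is_deriveM (is_derive_expRM (eta / K) t) (is_mx_derive_qform sQ (fd t))) _.
  by rewrite /dg /= -![_ *: _]/(_ * _); ring.
have dg0 t : dg t <= 0.
  rewrite /dg pmulr_rle0 ?expR_gt0//.
  have := hQ (Pif t); have := QK (f t); set a := qform _ _; set b := dot (f t) (f t) => h1 h2.
  have : eta / K * a <= eta * b by rewrite mulrAC ler_pdivrMr// -mulrA ler_pM2l// mulrC.
  lra.
have gle : g s <= g 0.
  have [|c _ h] := MVT_segment s0 (fun x _ => gd x).
    by apply: continuous_subspaceT; exact: derivable_continuous gd.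
  by rewrite -subr_le0 h mulr_le0_ge0// subr0.
rewrite -/(f s).
have h1 : q * dot (f s) (f s) <= K * L ^+ 2 * dot w w * expR (- (eta / K) * s).
  rewrite (le_trans (Qq _))//.
  have -> : qform Q (f s) = expR (- (eta / K) * s) * g s.
    by rewrite /g mulrA -expRD mulNr addNr expR0 mul1r.
  rewrite mulrC ler_wpM2r ?expR_ge0// (le_trans gle)//.
  rewrite /g mulr0 expR0 mul1r (le_trans (QK _))// -mulrA ler_wpM2l ?(ltW K_gt0)//.
  rewrite /f /Phi expmx0 mul1mx -!enorm_sqr -exprMn.
  by rewrite lerXn2r ?nnegrE ?mulr_ge0 ?enorm_ge0.
rewrite -(ler_pM2l q0) (le_trans h1)// le_eqVlt; apply/orP; left; apply/eqP.
by field; rewrite gt_eqF.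
Qed.

Let E (s : R) := (Phi s)^T *m Phi s.

Lemma is_mx_derive_gram s : is_mx_derive s E (X^T *m E s + E s *m X).
Proof.
have Pd : is_mx_derive s Phi (Phi s *m X).
  have -> : Phi s *m X = X *m expmx (s *: X) *m Pi.
    by rewrite /Phi -mulmxA PiX mulmxA -(expmx_comm s (erefl (X *m X))).
  by apply: is_mx_derive_mulr; exact: is_mx_derive_expmx.
have := is_mx_derive_mul (is_mx_derive_tr Pd) Pd.
by rewrite trmx_mul /E !mulmxA.
Qed.

Lemma gramian_lyapunov (G : 'M[R]_d) :
  G = \matrix_(i, j) \int[lebesgue_measure]_(s in `[0, +oo[)
    (Pi^T *m expmx (s *: X^T) *m expmx (s *: X) *m Pi) i j ->
  G^T = G /\ X^T *m G + G *m X = - Pi.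
Proof.
move=> GE0.
have GE i j : G i j = \int[lebesgue_measure]_(s in `[0, +oo[) E s i j.
  rewrite GE0 mxE; apply: eq_Rintegral => s _.
  by rewrite expmx_tr /E /Phi trmx_mul !mulmxA.
have sE s : (E s)^T = E s by rewrite /E trmx_mul trmxK.
have [eps e0 [K K0 PhiK]] := projected_flow_decay.
have EK s : 0 <= s -> forall i j, `|E s i j| <= K * expR (- eps * s).
  move=> s0 i j.
  have Ed : E s i j = dot (Phi s *m delta_mx i ord0) (Phi s *m delta_mx j ord0).
    by rewrite dot_mull mulmxA -colE /dot trmx_delta -rowE !mxE.
  have dd k : dot (delta_mx k ord0 : 'cV[R]_d) (delta_mx k ord0) = 1.
    rewrite dotE (bigD1 k)//= !mxE !eqxx mulr1 big1 ?addr0// => l lk.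
    by rewrite !mxE (negPf lk) mul0r.
  have := PhiK (delta_mx i ord0) s s0; have := PhiK (delta_mx j ord0) s s0.
  rewrite !dd mulr1 Ed; set a := Phi s *m _; set b := Phi s *m _ => h1 h2.
  (* 2 |<a, b>| <= |a|^2 + |b|^2 bounds an arbitrary entry by diagonal ones. *)
  have := dot_ge0 (a + b); have := dot_ge0 (a - b).
  rewrite !dotDl !dotDr !dotNl !dotNr (dotC b a) ler_norml => h3 h4.
  by apply/andP; split; lra.
have Ed s := is_mx_derive_gram s.
(* The derivative of [E]; it satisfies an equation of the same form, which supplies the continuity
   of the integrand. *)
pose E1 s := X^T *m E s + E s *m X.
have E1d s : is_mx_derive s E1 (X^T *m E1 s + E1 s *m X).
  by apply: is_mx_derive_add; [exact: is_mx_derive_mull|exact: is_mx_derive_mulr].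
have hE1 i j : has_Rint (fun s => E1 s i j) (- E 0 i j).
  pose K1 := (\sum_l `|X l i| + \sum_l `|X l j|) * K.
  have K10 : 0 <= K1 by rewrite mulr_ge0// addr_ge0// sumr_ge0.
  have E1K s : 0 <= s -> `|E1 s i j| <= K1 * expR (- eps * s).
    move=> s0; rewrite mxE (le_trans (ler_normD _ _))// /K1 -mulrA mulrDl !mulr_suml.
    rewrite lerD// mxE (le_trans (ler_norm_sum _ _ _))//; apply: ler_sum => l _.
      by rewrite mxE normrM ler_wpM2l// EK.
    by rewrite normrM mulrC ler_wpM2l// EK.
  apply: (@Rint_derivative_expR_decay _ (fun s => E s i j) _ _ (K + K1)) e0 (fun s => Ed s i j) (fun s => E1d s i j) _ _ => s s0.
    by rewrite (le_trans (E1K s s0))// ler_wpM2r ?expR_ge0// lerDr.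
  by rewrite (le_trans (EK s s0 i j))// ler_wpM2r ?expR_ge0// lerDl.
have hE i j : has_Rint (fun s => E s i j) (G i j).
  split; last by rewrite GE.
  apply: (integrable_expR_bound e0 _ (fun s s0 => EK s s0 i j)).
  exact: derivable_continuous (fun s => Ed s i j).
split; first by apply/matrixP => i j; rewrite mxE !GE; apply: eq_Rintegral => s _; rewrite -[in LHS]sE mxE.
apply/matrixP => i j.
(* The integral of [E1] is computed a second time, by linearity, and compared with [- E 0]. *)
have [_ <-] : has_Rint (fun s => E1 s i j) ((X^T *m G + G *m X) i j).
  rewrite mxE; under eq_fun do rewrite mxE.
  apply: has_RintD.
    rewrite mxE; under eq_fun do rewrite mxE.
    by apply: has_Rint_sum => l; exact: has_RintZ.
  rewrite mxE; under eq_fun do rewrite mxE.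
  apply: has_Rint_sum => l; rewrite mulrC.
  by under eq_fun do rewrite mulrC; exact: has_RintZ.
have [_ ->] := hE1 i j; rewrite /E /Phi expmx0 mul1mx sPi PiPi !mxE//.
Qed.

End GramianLyapunov.

(** * Absolutely continuous functions *)

Section AbsoluteContinuity.
Context {R : realType}.
Notation mu := (@lebesgue_measure R).

(** Existence of fine tagged partitions, as an induction principle on intervals: the supremum of the
    [c] with [P a c] cannot stop short of [b]. *)
Lemma cousin (P : R -> R -> Prop) (a b : R) : a <= b ->
  (forall u w v, u <= w -> w <= v -> P u w -> P w v -> P u v) ->
  (forall t, a <= t -> t <= b -> exists2 r, 0 < r & forall u v,
     t - r < u -> u <= t -> t <= v -> v < t + r -> a <= u -> v <= b -> P u v) ->
  P a b.
Proof.
move=> ab Padd Ploc.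
pose S := [set c | [/\ a <= c, c <= b & P a c]].
have Sa : S a.
  by have [r r0 h] := Ploc a (lexx a) ab; split => //; apply: h; rewrite ?ltrDl// ltrBlDr ltrDl.
have supS : has_sup S by split; [exists a|exists b => c []].
have as' : a <= sup S by exact: (sup_upper_bound supS).
have sb : sup S <= b by apply: sup_le_ub; [exists a|move=> c []].
have [r r0 h] := Ploc _ as' sb.
have [c [ac cb Pc] cs] := sup_adherent r0 supS.
have cS : c <= sup S by apply: (sup_upper_bound supS).
(* An interval from [c] around the tag [sup S] either reaches [b] or overshoots the supremum. *)
have [bs|bs] := leP b (sup S + r / 2).
  apply: (Padd a c b) => //; apply: h => //.
  by rewrite (le_lt_trans bs)// ltrD2l; lra.
have : S (sup S + r / 2).
  have sr : sup S <= sup S + r / 2 by rewrite lerDl; lra.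
  split; [exact: le_trans sr|exact: ltW|].
  apply: (Padd a c) => //; first exact: le_trans sr.
  by apply: h => //; [rewrite ltrD2l; lra|exact: ltW].
by move=> /(sup_upper_bound supS); lra.
Qed.

Lemma is_derive_linear_approx (f : R -> R) (t f' : R) : is_derive t 1 f f' ->
  forall eps, 0 < eps -> exists2 r, 0 < r & forall y, `|y - t| < r ->
    `|f y - f t - f' * (y - t)| <= eps * `|y - t|.
Proof.
move=> [df <-] eps e0; move/cvgrPdist_le: df => /(_ _ e0) [r /= r0 h].
exists r => // y yr; have [->|yt] := eqVneq y t; first by rewrite !subrr mulr0 subrr normr0 mulr0.
have := h (y - t); rewrite /ball_ /= sub0r normrN subr_eq0 => /(_ yr yt).
rewrite -[(y - t) *: 1]/((y - t) * 1) mulr1 subrK => h1.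
have yt0 : 0 < `|y - t| by rewrite normr_gt0 subr_eq0.
rewrite -(ler_pM2r yt0) -normrM in h1; rewrite -normrN (le_trans _ h1)// le_eqVlt.
apply/orP; left; apply/eqP; congr `|_|.
rewrite -[_ *: (f y - _)]/(_ * _) /derive; field.
by rewrite subr_eq0.
Qed.

Definition ac (a b : R) (f : R -> R) : Prop :=
  forall eps : R, 0 < eps -> exists2 delta : R, 0 < delta &
    forall (k : nat) (s t : 'I_k -> R),
      (forall i, [/\ a <= s i, s i < t i & t i <= b]) ->
      (forall i j, i != j -> t i <= s j \/ t j <= s i) ->
      \sum_(i < k) (t i - s i) < delta ->
      \sum_(i < k) `|f (t i) - f (s i)| < eps.

(** Around a tag outside [Z] the increment is at most [eps] times the length; the intervals tagged
    in [Z] contribute less than [eps] altogether. *)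
Lemma ac_nonincreasing (a b : R) (f : R -> R) (Z : set R) : a <= b ->
  ac a b f -> mu.-negligible Z ->
  (forall t, a <= t -> t <= b -> ~ Z t -> exists2 f', is_derive t 1 f f' & f' <= 0) ->
  f b <= f a.
Proof.
move=> ab acf [A [mA A0 ZA]] df.
suff H eps : 0 < eps -> f b - f a <= eps * (b - a) + eps.
  rewrite -subr_le0; apply/ler_addgt0Pr => eps e0; rewrite add0r.
  have d0 : 0 < b - a + 1 by rewrite ltr_wpDl ?subr_ge0.
  rewrite (le_trans (H (eps / (b - a + 1)) _)) ?divr_gt0//.
  by rewrite -[X in _ + X]mulr1 -mulrDr divfK// gt_eqF.
move=> e0; have [delta d0 Hd] := acf _ e0.
have Afin : (mu A < +oo)%E by rewrite A0 ltry.
have [U [oU AU mUA]] := lebesgue_regularity_outer mA Afin d0.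
have mU : measurable U by exact: open_measurable.
have muU : (mu U < delta%:E)%E.
  have h : (mu U <= mu A + mu (U `\` A))%E.
    by rewrite -{1}(setDUK AU) measureU2//; exact: measurableD.
  by rewrite (le_lt_trans h)// A0 add0e.
have mI (u v : R) : measurable (U `&` `]u, v]) by exact: measurableI.
have fI (u v : R) : (mu (U `&` `]u, v]) <= mu U)%E by apply: le_measure; [rewrite inE; exact: mI|rewrite inE; exact: mU|exact: subIsetl].
have fnI (u v : R) : mu (U `&` `]u, v]) \is a fin_num.
  by rewrite ge0_fin_numE// (le_lt_trans (fI u v))// (lt_trans muU)// ltry.
(* Half-open intervals make [m] additive over adjacent intervals. *)
pose m (u v : R) := fine (mu (U `&` `]u, v])).
have m0 u v : 0 <= m u v by rewrite fine_ge0.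
have mD u w v : u <= w -> w <= v -> m u v = m u w + m w v.
  move=> uw wv; rewrite /m -fineD//.
  have disj : (U `&` `]u, w]) `&` (U `&` `]w, v]) = set0.
    apply/seteqP; split => // x [[_ /=]]; rewrite in_itv /= => /andP[_ xw] [_ /=].
    by rewrite in_itv /= ltNge xw.
  rewrite -(measureU mu (mI u w) (mI w v) disj); congr (fine (mu _)).
  by rewrite -setIUr -itv_bndbnd_setU// bnd_simp.
(* [L] collects the intervals tagged in [Z]; they lie in [U], whose measure is less
   than [delta], so absolute continuity bounds the increments of [f] over them. *)
pose P (u v : R) := exists L : seq (R * R),
  [/\ all (fun p => [&& u <= p.1, p.1 < p.2 & p.2 <= v]) L,
      pairwise (fun p q => p.2 <= q.1) L,
      \sum_(p <- L) (p.2 - p.1) <= m u v &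
      f v - f u <= eps * (v - u) + \sum_(p <- L) (f p.2 - f p.1)].
have [L [/allP Lab Lpw Lm Lf]] : P a b.
  apply: cousin => //.
    move=> u w v uw wv [L1 [/allP a1 p1 s1 f1]] [L2 [/allP a2 p2 s2 f2]].
    exists (L1 ++ L2); split.
    - rewrite all_cat; apply/andP; split; apply/allP => p.
        by move=> /a1 /and3P[-> -> h]; rewrite (le_trans h wv).
      by move=> /a2 /and3P[h -> ->]; rewrite (le_trans uw h).
    - rewrite pairwise_cat p1 p2 !andbT; apply/allrelP => p q.
      by move=> /a1/and3P[_ _ h1] /a2/and3P[h2 _ _]; exact: le_trans h1 h2.
    - by rewrite big_cat /= (mD u w v)// lerD.
    - by rewrite big_cat /=; lra.
  move=> t at' tb; have [Zt|Zt] := pselect (Z t).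
    have /nbhs_ballP[r /= r0 rU] : nbhs t U by apply: open_nbhs_nbhs; split => //; exact/AU/ZA.
    exists r => // u v ru ut tv vr au vb.
    (* Absolute continuity accepts only pairs with [s i < t i], so a degenerate interval gets the
       empty list. *)
    have [uv|uv] := ltP u v; last first.
      have -> : u = v by apply/eqP; rewrite eq_le uv (le_trans ut tv).
      by exists [::]; split; rewrite ?big_nil ?subrr ?mulr0 ?addr0//.
    exists [:: (u, v)]; split => //=; rewrite ?lexx ?uv// ?big_seq1.
      rewrite /m (_ : U `&` _ = `]u, v]%classic); last first.
        apply/setIidr => x; rewrite /= in_itv /= => /andP[ux xv]; apply: rU.
        by rewrite /ball /= ltr_norml; apply/andP; split; lra.
      by rewrite lebesgue_measure_itv /= lte_fin uv -EFinB.
    by rewrite lerDr mulr_ge0 ?subr_ge0// ltW.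
  have [f' fd f'0] := df t at' tb Zt.
  have [r r0 h] := is_derive_linear_approx fd e0.
  exists r => // u v ru ut tv vr au vb.
  exists [::]; split; rewrite ?big_nil ?addr0//.
  (* The tag lies between [u] and [v]; the linear approximation is used on both sides of it. *)
  have hu : `|u - t| < r by rewrite ltr_norml; apply/andP; split; lra.
  have hv : `|v - t| < r by rewrite ltr_norml; apply/andP; split; lra.
  have := h u hu; have := h v hv.
  rewrite (ger0_norm (_ : 0 <= v - t)) ?subr_ge0// (ler0_norm (_ : u - t <= 0)) ?subr_le0//.
  rewrite !ler_norml => /andP[_ h1] /andP[h2 _].
  have : f' * (v - t) <= 0 by rewrite mulr_le0_ge0 ?subr_ge0.
  have : 0 <= f' * (u - t) by rewrite mulr_le0 ?subr_le0.
  lra.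
rewrite (le_trans Lf)// lerD2l.
pose s (i : 'I_(size L)) := (nth (0, 0) L i).1.
pose t (i : 'I_(size L)) := (nth (0, 0) L i).2.
have sumL (F : R * R -> R) : \sum_(p <- L) F p = \sum_(i < size L) F (nth (0, 0) L i).
  by rewrite (big_nth (0, 0)) big_mkord.
apply/ltW; rewrite sumL; apply: le_lt_trans (Hd _ s t _ _ _).
- by apply: ler_sum => i _; exact: ler_norm.
- by move=> i; have /and3P[] := Lab _ (mem_nth (0, 0) (ltn_ord i)).
- move=> i j ij; have /(pairwiseP (0, 0)) pw := Lpw.
  have [ij'|ji|/val_inj e] := ltngtP i j; last by rewrite e eqxx in ij.
    by left; apply: pw; rewrite ?inE.
  by right; apply: pw; rewrite ?inE.
- have := Lm; rewrite sumL => /le_lt_trans; apply.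
  by rewrite -lte_fin /m fineK// (le_lt_trans (fI a b)).
Qed.

End AbsoluteContinuity.

Section AbsoluteContinuityAlgebra.
Context {R : realType} {a b : R}.
Implicit Types f g : R -> R.

Lemma ac_cst c : ac a b (fun=> c).
Proof.
move=> eps e0; exists 1 => // k s t _ _ _.
by rewrite big1// => i _; rewrite subrr normr0.
Qed.

Lemma ac_uniform f eps : ac a b f -> 0 < eps -> exists2 r, 0 < r &
  forall s t, a <= s -> s <= t -> t <= b -> t - s < r -> `|f t - f s| < eps.
Proof.
move=> acf e0; have [r r0 h] := acf _ e0; exists r => // s t as' st tb ts.
have [<-|st'] := eqVneq s t; first by rewrite subrr normr0.
have := h 1%N (fun=> s) (fun=> t); rewrite !big_ord1; apply => //.
  by move=> _; rewrite lt_neqAle st' st.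
by move=> i j; rewrite (ord1 i) (ord1 j) eqxx.
Qed.

Lemma ac_bounded f : ac a b f ->
  exists2 K, 0 <= K & forall t, a <= t -> t <= b -> `|f t| <= K.
Proof.
move=> /ac_uniform/(_ (@ltr01 _)) [r r0 h].
(* Steps of length r / 2 stay below the modulus [r], and each changes [f] by less than 1. *)
pose n := (Num.trunc ((b - a) / (r / 2))).+1.
have bn : b <= a + n%:R * (r / 2).
  have r20 : 0 < r / 2 by rewrite divr_gt0.
  by rewrite -lerBlDl -ler_pdivrMr// ltW// truncnS_gt.
exists (`|f a| + n%:R); first by rewrite addr_ge0.
move=> t at' tb.
have : t <= a + n%:R * (r / 2) by exact: le_trans bn.
elim: n t at' tb {bn} => [|m IH] t at' tb tm.
  have -> : t = a by apply/eqP; rewrite eq_le at' andbT; move: tm; rewrite mul0r addr0.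
  by rewrite addr0.
have [tr|tr] := leP t (a + r / 2).
  have := h a t (lexx a) at' tb; rewrite -natr1 => /(_ _) h1.
  have : `|f t - f a| < 1 by apply: h1; lra.
  have := ler_normD (f t - f a) (f a); rewrite subrK.
  have : 0 <= m%:R :> R by []. lra.
have := IH (t - r / 2); rewrite lerBrDr ltW// lerBlDr.
move=> /(_ isT) H1; have {}H1 : `|f (t - r / 2)| <= `|f a| + m%:R.
  apply: H1; first by rewrite (le_trans tb)// lerDl ltW// divr_gt0.
  by move: tm; rewrite -natr1; lra.
have : `|f t - f (t - r / 2)| < 1 by apply: h => //; lra.
have := ler_normD (f t - f (t - r / 2)) (f (t - r / 2)); rewrite subrK -natr1; lra.
Qed.

(** Sums, products and negations all reduce to this domination of increments. *)
Lemma ac_comb f g h K L : 0 <= K -> 0 <= L -> ac a b f -> ac a b g ->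
  (forall s t, a <= s -> s <= t -> t <= b ->
     `|h t - h s| <= K * `|f t - f s| + L * `|g t - g s|) ->
  ac a b h.
Proof.
move=> K0 L0 acf acg H eps e0.
have S0 : 0 < 2 * (K + L + 1) by lra.
have e'0 : 0 < eps / (2 * (K + L + 1)) by rewrite divr_gt0.
have [r r0 hr] := acf _ e'0; have [r' r'0 hr'] := acg _ e'0.
exists (Num.min r r'); first by rewrite lt_min r0.
move=> k s t st dis; rewrite lt_min => /andP[h1 h2].
have {h1}h1 := hr k s t st dis h1; have {h2}h2 := hr' k s t st dis h2.
set u := eps / _ in h1 h2 e'0.
apply: (@le_lt_trans _ _ (K * u + L * u)).
  apply: (@le_trans _ _ (\sum_(i < k) (K * `|f (t i) - f (s i)| + L * `|g (t i) - g (s i)|))).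
    by apply: ler_sum => i _; have [h3 h4 h5] := st i; apply: H => //; exact: ltW.
  by rewrite big_split /= -!mulr_sumr lerD// ler_wpM2l// ltW.
have : u * (2 * (K + L + 1)) = eps by rewrite /u divfK// gt_eqF.
nra.
Qed.

Lemma acD f g : ac a b f -> ac a b g -> ac a b (fun s => f s + g s).
Proof.
move=> acf acg; apply: (ac_comb ler01 ler01 acf acg) => s t _ _ _.
by rewrite !mul1r opprD addrACA ler_normD.
Qed.

Lemma acM f g : ac a b f -> ac a b g -> ac a b (fun s => f s * g s).
Proof.
move=> acf acg.
have [K K0 fK] := ac_bounded acf; have [L L0 gL] := ac_bounded acg.
apply: (ac_comb L0 K0 acf acg) => s t as' st tb.
have -> : f t * g t - f s * g s = (f t - f s) * g t + f s * (g t - g s) by ring.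
rewrite (le_trans (ler_normD _ _))// !normrM mulrC lerD// ler_wpM2r//.
  by apply: gL => //; exact: le_trans st.
by apply: fK => //; exact: le_trans tb.
Qed.

Lemma ac_lipschitz f K : 0 <= K ->
  (forall s t, a <= s -> s <= t -> t <= b -> `|f t - f s| <= K * (t - s)) -> ac a b f.
Proof.
move=> K0 fK eps e0; have K1 : 0 < K + 1 by lra.
exists (eps / (K + 1)); first by rewrite divr_gt0.
move=> k s t st _ h; rewrite ltr_pdivlMr// in h; apply: le_lt_trans h.
rewrite mulr_suml; apply: ler_sum => i _; have [h3 h4 h5] := st i.
rewrite (le_trans (fK _ _ h3 (ltW h4) h5))// mulrC ler_wpM2l ?subr_ge0 ?(ltW h4)//.
by rewrite lerDl.
Qed.

(** A continuous derivative is bounded on a compact interval, so [f] is Lipschitz there. *)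
Lemma ac_is_derive f df : (forall t : R, is_derive t 1 f (df t)) -> continuous df -> ac a b f.
Proof.
move=> fd cdf; have [ba|ab] := ltP b a.
  move=> eps e0; exists 1 => // k s t st _ _.
  case: k s t st => [|k] s t st; first by rewrite big_ord0.
  by have [h1 h2 h3] := st ord0; move: (lt_le_trans (le_lt_trans h1 h2) h3) ba; lra.
have [c _ hc] := @EVT_max R (fun t => `|df t|) a b ab
  (continuous_subspaceT (fun t => continuous_comp (cdf t) (@norm_continuous _ _ _))).
apply: (@ac_lipschitz _ `|df c|) => // s t as' st tb.
have [|u ust ->] := MVT_segment st (fun x _ => fd x).
  by apply: continuous_subspaceT; exact: derivable_continuous fd.
rewrite normrM (ger0_norm (_ : 0 <= t - s)) ?subr_ge0// ler_wpM2r ?subr_ge0//.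
by apply: hc; move: ust; rewrite !in_itv /= => /andP[h1 h2]; rewrite (le_trans as')//= (le_trans h2).
Qed.

Definition mx_ac {m n : nat} (F : R -> 'M[R]_(m, n)) :=
  forall i j, ac a b (fun s => F s i j).

Lemma ac_sum (I : finType) (F : I -> R -> R) :
  (forall i, ac a b (F i)) -> ac a b (fun s => \sum_i F i s).
Proof.
move=> acF; elim: (index_enum I) => [|i r IH].
  by under eq_fun do rewrite big_nil; exact: ac_cst.
by under eq_fun do rewrite big_cons; exact: (acD (acF i) IH).
Qed.

Lemma mx_ac_mul {m n p : nat} (F : R -> 'M[R]_(m, n)) (G : R -> 'M[R]_(n, p)) :
  mx_ac F -> mx_ac G -> mx_ac (fun s => F s *m G s).
Proof.
move=> acF acG i j; under eq_fun do rewrite mxE.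
apply: (@ac_sum _ (fun k s => F s i k * G s k j)) => k.
exact: acM (acF i k) (acG k j).
Qed.

Lemma mx_ac_mull {m n p : nat} (K : 'M[R]_(m, n)) (G : R -> 'M[R]_(n, p)) :
  mx_ac G -> mx_ac (fun s => K *m G s).
Proof. by apply: mx_ac_mul => i j; exact: ac_cst. Qed.

Lemma mx_ac_qform {d : nat} (Q : 'M[R]_d) (F : R -> 'cV[R]_d) :
  mx_ac F -> ac a b (fun s => qform Q (F s)).
Proof.
move=> acF; rewrite /qform; under eq_fun do rewrite -mulmxA.
have h : mx_ac (fun s => (F s)^T *m (Q *m F s)).
  apply: (@mx_ac_mul _ _ _ (fun s => (F s)^T) (fun s => Q *m F s)); last exact: mx_ac_mull.
  by move=> i j; under eq_fun do rewrite mxE; exact: acF.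
exact: (h ord0 ord0).
Qed.

Lemma mx_ac_sub {m n : nat} (F G : R -> 'M[R]_(m, n)) :
  mx_ac F -> mx_ac G -> mx_ac (fun s => F s - G s).
Proof.
move=> acF acG i j; under eq_fun do rewrite !mxE.
apply: (acD (g := fun s => - G s i j) (acF i j)).
apply: (ac_comb ler01 ler01 (acG i j) (ac_cst 0)) => s t _ _ _.
by rewrite !mul1r -opprD normrN subrr normr0 addr0.
Qed.

Lemma absolutely_continuous_mx_ac {d : nat} (F : R -> 'cV[R]_d) :
  absolutely_continuous a b F -> mx_ac F.
Proof.
move=> acF i j eps e0; have [r r0 h] := acF _ e0; exists r => // k s t st dis /(h k s t st dis).
apply: le_lt_trans; apply: ler_sum => l _; rewrite (ord1 j) -[X in X <= _]sqrtr_sqr /enorm.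
rewrite ler_sqrt; last by rewrite sumr_ge0// => ? _; exact: sqr_ge0.
by rewrite (bigD1 i)//= !mxE lerDl sumr_ge0// => ? _; exact: sqr_ge0.
Qed.

End AbsoluteContinuityAlgebra.
Arguments mx_ac {R} a b {m n} F.

(** * Krasowskii directions of the quantized field *)

Section Krasowskii.
Context {R : realType}.

Lemma continuous_dot {d : nat} (a : 'cV[R]_d) : continuous (dot a).
Proof.
have -> : dot a = fun y : 'cV[R]_d => \sum_i a i ord0 * y i ord0.
  by apply/funext => y; rewrite dotE.
apply: continuous_big => [|i _ x]; first exact: add_continuous.
exact: cvgMl_tmp (@coord_continuous R d 1 i ord0 x).
Qed.

(* Half-spaces are closed and convex, so they test membership in the hull. *)
Lemma krasowskii_dot_le {d : nat} (F : 'cV[R]_d -> 'cV[R]_d) (a x w : 'cV[R]_d) (c : R) :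
  (forall eps, 0 < eps -> exists2 r, 0 < r & forall y, enorm (y - x) < r ->
     dot a (F y) <= c + eps) ->
  krasowskii F x w -> dot a w <= c.
Proof.
move=> H kw; apply/ler_addgt0Pr => eps e0; have [r r0 h] := H _ e0.
have := kw r r0 [set z | dot a z <= c + eps]; apply; split.
- apply: (@preimage_closed _ _ (dot a) [set z | z <= c + eps]).
    by move=> z _; exact: continuous_dot.
  exact: closed_le.
- apply/convex_setW => y z; rewrite !inE /= => hy hz l l0 l1.
  rewrite inE /= dotDr !dotZr.
  change (l%:num * dot a y + (1 - l%:num) * dot a z <= c + eps).
  have := ler_wpM2l (ltW l0) hy; have := ler_wpM2l (_ : 0 <= 1 - l%:num) hz.
  by rewrite subr_ge0 => /(_ (ltW l1)); lra.
- by move=> _ [y /= yx <-]; exact: h.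
Qed.

Lemma quantizer_error (Delta r : R) : 0 < Delta -> `|quantizer Delta r - r| <= Delta / 2.
Proof.
move=> D0; rewrite /quantizer; set z := r / Delta.
have -> : r = Delta * z by rewrite /z mulrC divfK// gt_eqF.
have := floor_le (z + 2^-1); have := floorD1_gt (z + 2^-1).
rewrite intrD -mulrBr normrM (gtr0_norm D0) ler_pM2l// ler_norml => h1 h2.
by apply/andP; split; lra.
Qed.

Lemma quantizer_mx_error {m : nat} (Delta : R) (z : 'cV[R]_m) : 0 < Delta ->
  enorm (map_mx (quantizer Delta) z - z) <= Num.sqrt m%:R * (Delta / 2).
Proof.
move=> D0; have D2 : 0 <= Delta / 2 by lra.
rewrite -(ler_pXn2r (n := 2)) ?nnegrE ?(mulr_ge0 (sqrtr_ge0 _) D2) ?enorm_ge0//.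
have -> : (Num.sqrt m%:R * (Delta / 2)) ^+ 2 = \sum_(i < m) (Delta / 2) ^+ 2.
  by rewrite sumr_const card_ord exprMn sqr_sqrtr ?ler0n// mulr_natl.
rewrite enorm_sqr dotE.
apply: ler_sum => i _; rewrite !mxE -expr2 -real_normK ?num_real//.
by rewrite lerXn2r ?nnegrE// quantizer_error.
Qed.

(** The field is the linear closed loop minus the input matrix applied to the quantization error.
    The error bound is uniform, so the discontinuities need not be located, and the linear part is
    continuous at [x]. *)
Lemma krasowskii_quantized_dot_le {N M n p : nat} (D : 'M[R]_(N, M))
    (A : 'M[R]_n) (B : 'M[R]_(n, p)) (C : 'M[R]_(p, n)) (Delta : R) a x w :
  0 < Delta -> krasowskii (quantized_field D A B C Delta) x w ->
  dot a w <= dot a (A_tilde D A B C *m x) +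
    enorm (((1%:M *t B) *m (D *t 1%:M))^T *m a) * (Num.sqrt (M * p)%N%:R * (Delta / 2)).
Proof.
move=> D0; apply: krasowskii_dot_le => eps e0.
set G := (1%:M *t B) *m (D *t 1%:M); set At := A_tilde D A B C.
set c := enorm (At^T *m a).
have c1 : 0 < c + 1 by have := enorm_ge0 (At^T *m a); rewrite -/c; lra.
exists (eps / (c + 1)); first by rewrite divr_gt0.
move=> y yx; set z := (D^T *t 1%:M) *m ((1%:M *t C) *m y).
have -> : quantized_field D A B C Delta y = At *m y - G *m (map_mx (quantizer Delta) z - z).
  rewrite /quantized_field /At /A_tilde /G -/z.
  have <- : (D *t 1%:M) *m (D^T *t (1%:M : 'M[R]_p)) = (D *m D^T) *t 1%:M.
    by rewrite tensmx_mul mulmx1.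
  rewrite mulmxBr !mulmxBl /z -!mulmxA opprB addrA; congr (_ - _).
  by rewrite subrK.
have -> : At *m y = At *m x + At *m (y - x) by rewrite mulmxBr addrC subrK.
rewrite dotDr dotNr dotDr (dot_mulr At a (y - x)) (dot_mulr G) -dotNr.
set v := map_mx _ _ - _.
have h1 := dot_le_enorm (At^T *m a) (y - x).
have h2 := dot_le_enorm (G^T *m a) (- v).
have h3 : enorm (- v) <= Num.sqrt (M * p)%N%:R * (Delta / 2).
  by rewrite enormN quantizer_mx_error.
have h4 : c * enorm (y - x) <= eps.
  rewrite ltr_pdivlMr// in yx; have := enorm_ge0 (y - x); rewrite mulrC in yx.
  by have c0 := enorm_ge0 (At^T *m a); rewrite -/c in c0; nra.
have h5 := ler_wpM2l (enorm_ge0 (G^T *m a)) h3.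
rewrite -/c in h1; lra.
Qed.

End Krasowskii.

(** * Differential inequalities holding almost everywhere *)

Section AlmostEverywhereODE.
Context {R : realType}.
Notation mu := (@lebesgue_measure R).

Lemma ac_expRM (a b c : R) : ac a b (fun s => expR (c * s)).
Proof.
apply: (ac_is_derive (is_derive_expRM c)).
exact: derivable_continuous (fun x => is_deriveZ c (is_derive_expRM c x)).
Qed.

(** e^(alpha s) (v s - beta) is nonincreasing, so the excess of [v] over [beta] decays exponentially
    and falls below [eps] in finite time. *)
Lemma ac_ultimate_bound (v : R -> R) (alpha beta eps : R) (Z : set R) :
  0 < alpha -> 0 < eps -> mu.-negligible Z -> (forall T, 0 < T -> ac 0 T v) ->
  (forall t, 0 <= t -> ~ Z t -> exists2 v', is_derive t 1 v v' & v' <= - alpha * (v t - beta)) ->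
  exists2 T, 0 <= T & forall t, T <= t -> v t <= beta + eps.
Proof.
move=> al0 e0 Z0 acv dv.
have ae : 0 < alpha * eps by rewrite mulr_gt0.
(* Chosen so that e^x >= 1 + x, without logarithms, yields |v 0 - beta| <= e^(alpha t) eps. *)
exists (`|v 0 - beta| / (alpha * eps)); first by rewrite divr_ge0// ltW.
move=> t; rewrite ler_pdivrMr// => Tt.
have t0 : 0 <= t.
  by rewrite -(pmulr_lge0 _ ae) (le_trans _ Tt).
have h1 : v 0 - beta <= expR (alpha * t) * eps.
  rewrite (le_trans (ler_norm _))// (le_trans Tt)//.
  have := expR_ge1Dx (alpha * t); nra.
have [t00|t00] := eqVneq t 0.
  by move: h1; rewrite t00 mulr0 expR0 mul1r lerBlDl.
have tp : 0 < t by rewrite lt_neqAle eq_sym t00.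
pose w s := expR (alpha * s) * (v s + - beta).
have : w t <= w 0.
  apply: (@ac_nonincreasing _ 0 t w Z t0) => //.
    by apply: acM; [exact: ac_expRM|apply: acD; [exact: acv|exact: ac_cst]].
  move=> s s0 _ Zs; have [v' vd v'le] := dv s s0 Zs.
  exists (expR (alpha * s) * (alpha * (v s - beta) + v')).
    apply: is_derive_eq (is_deriveM (is_derive_expRM alpha s) (is_deriveD vd (is_derive_cst (- beta) s 1))) _.
    rewrite addr0 -![_ *: _]/(_ * _) -[(v + _) s]/(v s - beta); ring.
  by rewrite pmulr_rle0 ?expR_gt0//; lra.
rewrite /w mulr0 expR0 mul1r => h2.
have := le_trans h2 h1; rewrite ler_pM2l ?expR_gt0//; lra.
Qed.

(** Gronwall's uniqueness argument: e^(- 2 K t) |eta t|^2 is nonincreasing, nonnegative and starts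
    at zero. *)
Lemma ac_linear_zero {n : nat} (A : 'M[R]_n) (eta : R -> 'cV[R]_n) (T : R) (Z : set R) :
  0 <= T -> mu.-negligible Z -> mx_ac 0 T eta ->
  (forall t, 0 <= t -> t <= T -> ~ Z t -> is_mx_derive t eta (A *m eta t)) ->
  eta 0 = 0 -> eta T = 0.
Proof.
move=> T0 Z0 acx dx x0.
have [K K0 AK] := enorm_mulmx_bounded A.
have sI : (1%:M : 'M[R]_n)^T = 1%:M by rewrite trmx1.
pose g s := expR (- (2 * K) * s) * qform 1%:M (eta s).
have : g T <= g 0.
  apply: (@ac_nonincreasing _ 0 T g Z T0) => //.
    by apply: acM; [exact: ac_expRM|exact: mx_ac_qform].
  move=> t t0 tT Zt.
  have dq := is_mx_derive_qform sI (dx t t0 tT Zt).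
  exists (expR (- (2 * K) * t) * (- (2 * K) * qform 1%:M (eta t) + 2 * dot (eta t) (1%:M *m (A *m eta t)))).
    apply: is_derive_eq (is_deriveM (is_derive_expRM _ t) dq) _.
    by rewrite /= -![_ *: _]/(_ * _) /=; ring.
  rewrite pmulr_rle0 ?expR_gt0// qformE !mul1mx.
  have := dot_le_enorm (eta t) (A *m eta t).
  have := AK (eta t); have := enorm_ge0 (eta t); rewrite -enorm_sqr.
  set u := enorm (eta t); set w := enorm _; set z := dot _ _ => u0 wu zuw.
  nra.
rewrite /g x0 !qformE !mul1mx dot0r mulr0 pmulr_rle0 ?expR_gt0// => h.
by apply: dot_eq0; apply/eqP; rewrite eq_le h dot_ge0.
Qed.

(** Continuity up to 0 bounds [x], hence its derivative [A *m x]; the mean value theorem uses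
    derivatives only inside the interval, so the solution is Lipschitz up to 0. *)
Lemma linear_solution_mx_ac {n : nat} (A : 'M[R]_n) x0 x (T : R) :
  linear_solution A x0 x -> 0 <= T -> mx_ac 0 T x.
Proof.
move=> [_ cx dx] T0.
have cxj j : {within `[0, T], continuous (fun t => x t j ord0)}.
  have h : {within `[0, T], continuous x}.
    by apply: continuous_subspaceW cx => t /=; rewrite !in_itv /= => /andP[->].
  move=> t; apply: (@continuous_comp (subspace `[0, T]) _ _ x (fun y : 'cV[R]_n => y j ord0)).
    exact: h.
  exact: coord_continuous.
have bnd j : exists K, 0 <= K /\ forall t, 0 <= t -> t <= T -> `|x t j ord0| <= K.
  have [c _ hc] := @EVT_max R (fun t => `|x t j ord0|) 0 T T0
    (fun t => @continuous_comp (subspace `[0, T]) _ _ (fun t => x t j ord0) _ t (cxj j t) (@norm_continuous _ _ _)).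
  exists `|x c j ord0|; split=> // t t0 tT; apply: hc.
  by rewrite in_itv /= t0.
have [K hK] := choice bnd.
move=> i j; rewrite (ord1 j).
apply: (@ac_lipschitz _ _ _ _ (\sum_l `|A i l| * K l)).
  by rewrite sumr_ge0// => l _; rewrite mulr_ge0//; case: (hK l).
move=> s t s0 st tT.
have [||u ust ->] := @MVT_segment _ (fun t => x t i ord0) (fun t => (A *m x t) i ord0) s t st.
- move=> u; rewrite in_itv /= => /andP[su ut].
  by have /is_derive_mx h := dx u (le_lt_trans s0 su); exact: h.
- apply: continuous_subspaceW (cxj i) => u /=; rewrite !in_itv /= => /andP[su ut].
  by rewrite (le_trans s0)// (le_trans ut).
rewrite normrM (ger0_norm (_ : 0 <= t - s)) ?subr_ge0// ler_wpM2r ?subr_ge0//.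
rewrite mxE (le_trans (ler_norm_sum _ _ _))//; apply: ler_sum => l _.
rewrite normrM ler_wpM2l//; apply: (hK l).2.
  by move: ust; rewrite in_itv /= => /andP[su ut]; exact: le_trans su.
by move: ust; rewrite in_itv /= => /andP[su ut]; exact: le_trans tT.
Qed.

Lemma expmx_linear_solution {n : nat} (A : 'M[R]_n) x0 :
  linear_solution A x0 (fun t => expmx (t *: A) *m x0).
Proof.
have d (t : R) : is_derive t 1 (fun t => expmx (t *: A) *m x0) (A *m (expmx (t *: A) *m x0)).
  apply/is_derive_mx; rewrite mulmxA; apply: is_mx_derive_mulr.
  exact: is_mx_derive_expmx.
split=> [||t _]; [by rewrite expmx0 mul1mx| |exact: d].
apply: continuous_subspaceT => t; apply/differentiable_continuous/derivable1_diffP.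
by case: (d t).
Qed.

Lemma krasowskii_solution_derive {d : nat} (F : 'cV[R]_d -> 'cV[R]_d) x :
  krasowskii_solution F x -> (forall T, 0 < T -> mx_ac 0 T x) /\
  exists2 Z, mu.-negligible Z & forall t, 0 <= t -> ~ Z t ->
    exists2 w, is_mx_derive t x w & krasowskii F (x t) w.
Proof.
move=> [acx aex]; split=> [T T0|]; first by apply: absolutely_continuous_mx_ac; exact: acx.
exists (~` [set t | 0 <= t -> derivable x t 1 /\ krasowskii F (x t) ('D_1 x t)]) => //.
move=> t t0 /contrapT /(_ t0) [xd xk].
by exists ('D_1 x t) => //; apply/is_derive_mx; exact: derivableP.
Qed.

End AlmostEverywhereODE.

(** * The average as a linear map *)

Section Average.
Context {R : realType} {N n : nat}.

Lemma averageE (x : 'cV[R]_(N * n)) : average x = N%:R^-1 *: \sum_i block i x.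
Proof.
apply/colP => j; rewrite /average castmxE /= /kron_average cast_ord_id.
have -> : cast_ord (esym (mul1n n)) j = mxtens_index (ord0, j) by exact: val_inj.
rewrite mxE [RHS]mxE mxE summxE sum_tens; congr (_ * _); apply: eq_bigr => i _.
rewrite (bigD1 j)//= tensmxE !mxE eqxx !mul1r big1 ?addr0// => l lj.
by rewrite tensmxE !mxE eq_sym (negPf lj) mulr0 mul0r.
Qed.

(** A matrix form of [average], so that the rules for constant left factors apply to it. *)
Definition average_mx : 'M[R]_(n, N * n) :=
  castmx (mul1n n, erefl (N * n)%N) (N%:R^-1 *: (ones^T *t (1%:M : 'M[R]_n))).

Lemma average_mxE (x : 'cV[R]_(N * n)) : average x = average_mx *m x.
Proof.
by rewrite /average /kron_average scalemxAl castmx_mul castmx_id.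
Qed.

Lemma consensus_projection (x : 'cV[R]_(N * n)) :
  x - (ones *t (1%:M : 'M[R]_n)) *m kron_average x = disagreement_mx *m x.
Proof.
rewrite disagreementE mulmxBl mul1mx /kron_average -scalemxAr mulmxA tensmx_mul mulmx1.
rewrite scalemxAl; congr (_ - _ *m _).
by apply/matrixP => i j; rewrite !mxE mulrA.
Qed.

End Average.

(** * Quantized consensus *)

Section QuantizedConsensus.
Context {R : realType} {N M n p : nat} (N0 : (0 < N)%N).
Variables (e : rel 'I_N) (pos neg : 'I_M -> 'I_N).
Hypotheses (e_irr : irreflexive e) (hlab : edge_labelling e pos neg).
Local Notation D := (incidence_mx pos neg : 'M[R]_(N, M)).
Variables (A : 'M[R]_n) (B : 'M[R]_(n, p)) (C : 'M[R]_(p, n)).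
Local Notation At := (A_tilde D A B C).
Local Notation G := ((1%:M *t B) *m (D *t (1%:M : 'M[R]_p))).
Local Notation Pi := (disagreement_mx : 'M[R]_(N * n)).
Local Notation Av := (average_mx : 'M[R]_(n, N * n)).

Lemma disagreement_input : Pi *m G = G.
Proof.
by rewrite tensmx_mul mul1mx mulmx1 /disagreement_mx tensmx_mul mul1mx
  (Pi_incidence e_irr hlab).
Qed.

Lemma average_input : Av *m G = 0.
Proof.
suff h (z : 'cV[R]_(M * p)) : Av *m (G *m z) = 0.
  apply/matrixP => i j; have := h (delta_mx j ord0).
  by rewrite mulmxA -colE => /matrixP/(_ i ord0); rewrite !mxE.
rewrite -average_mxE averageE tensmx_mul mul1mx mulmx1.
under eq_bigr do rewrite block_tens.
rewrite exchange_big big1 ?scaler0// => k _ /=.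
by rewrite (sum_incidence e_irr hlab (fun=> B *m block k z)) subrr.
Qed.

Lemma average_A_tilde (x : 'cV[R]_(N * n)) : Av *m (At *m x) = A *m (Av *m x).
Proof.
rewrite /A_tilde mulmxBl mulmxBr.
have -> : (1%:M *t B) *m ((D *m D^T) *t 1%:M) *m (1%:M *t C) =
    G *m ((D^T *t 1%:M) *m (1%:M *t C)).
  by rewrite !mulmxA; congr (_ *m _); rewrite -[RHS]mulmxA [in RHS]tensmx_mul mulmx1.
rewrite -mulmxA [X in _ - X]mulmxA average_input mul0mx subr0.
rewrite -!average_mxE !averageE -scalemxAr mulmx_sumr; congr (_ *: _).
by apply: eq_bigr => i _; exact: block_tens1.
Qed.

(** Tested on a row of [average_mx], the error term vanishes by [average_input]; both signs of the
    row turn the inequality into an equation. *)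
Lemma average_krasowskii (Delta : R) x w : 0 < Delta ->
  krasowskii (quantized_field D A B C Delta) x w -> Av *m w = A *m (Av *m x).
Proof.
move=> D0 kw; rewrite -average_A_tilde; apply/colP => j.
have dotE' z : dot (row j Av)^T z = (Av *m z) j ord0.
  by rewrite /dot trmxK -row_mul mxE.
have Ga (c : R) : G^T *m (c *: (row j Av)^T) = 0.
  by rewrite -scalemxAr -trmx_mul -row_mul average_input row0 trmx0 scaler0.
have h1 := krasowskii_quantized_dot_le (1 *: (row j Av)^T) D0 kw.
have h2 := krasowskii_quantized_dot_le ((-1) *: (row j Av)^T) D0 kw.
move: h1 h2; rewrite !Ga enorm0 mul0r !addr0 !dotZl !dotE' => h1 h2.
by apply/eqP; rewrite eq_le; apply/andP; split; lra.
Qed.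

Lemma input_tr_le (z : 'cV[R]_(N * n)) : enorm (G^T *m z) <=
  opnorm B * opnorm (D *t (1%:M : 'M[R]_p)) * enorm z.
Proof.
rewrite trmx_mul -mulmxA (le_trans (enorm_trmx_mulmx_le _ _))//.
rewrite (mulrC (opnorm B)) -mulrA ler_wpM2l ?opnorm_ge0//.
have [e0|e0] := eqVneq ((1%:M *t B)^T *m z) 0.
  by rewrite e0 enorm0 mulr_ge0 ?opnorm_ge0 ?enorm_ge0.
rewrite -(ler_pM2r (enorm_gt0 e0)) -expr2 enorm_sqr dot_mull trmxK.
rewrite (le_trans (dot_le_enorm _ _))//.
set y := _ *m z; have := enorm_tens1 B y; have := enorm_ge0 z; nra.
Qed.

Section Disagreement.
Variables (Rm : 'M[R]_(N * n)) (Delta : R).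
Hypotheses (sR : Rm^T = Rm) (lyapR : At^T *m Rm + Rm *m At = - Pi) (D0 : 0 < Delta).

Let b := Num.sqrt (M * p)%N%:R * Delta *
  (opnorm Rm * (opnorm B * opnorm (D *t (1%:M : 'M[R]_p)))).

Lemma disagreement_krasowskii x w :
  krasowskii (quantized_field D A B C Delta) x w ->
  2 * dot x (Pi *m Rm *m Pi *m w) <= - enorm (Pi *m x) ^+ 2 + b * enorm (Pi *m x).
Proof.
move=> kw; set y := Pi *m x.
have Piy : Pi *m y = y by rewrite /y mulmxA disagreement_idem.
(* The tested direction is the gradient of the Lyapunov function at [x]; its factor 2 cancels the
   one in Delta / 2. *)
have h := krasowskii_quantized_dot_le (2 *: (Pi *m (Rm *m y))) D0 kw.
have -> : 2 * dot x (Pi *m Rm *m Pi *m w) = dot (2 *: (Pi *m (Rm *m y))) w.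
  by rewrite dotZl -!mulmxA dot_mulr disagreement_tr -/y dot_mulr sR dot_mulr disagreement_tr.
rewrite (le_trans h)// lerD//.
  rewrite dotZl dot_mull disagreement_tr mulmxA (disagreement_A_tilde e_irr hlab) -mulmxA -/y.
  have : dot y ((At^T *m Rm + Rm *m At) *m y) = - enorm y ^+ 2.
    by rewrite lyapR mulNmx dotNr Piy enorm_sqr.
  rewrite mulmxDl dotDr -!mulmxA dot_mulr trmxK (dot_mulr Rm y) sR (dotC (At *m y)).
  lra.
rewrite -scalemxAr enormZ ger0_norm//.
have -> : G^T *m (Pi *m (Rm *m y)) = G^T *m (Rm *m y).
  have := congr1 trmx disagreement_input.
  by rewrite (trmx_mul Pi) disagreement_tr => GP; rewrite (mulmxA G^T) GP.
have h1 := input_tr_le (Rm *m y).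
have h2 := enorm_mulmx_le Rm y.
set c := opnorm B * _ in h1 *.
have c0 : 0 <= c by rewrite mulr_ge0 ?opnorm_ge0.
have h3 : enorm (G^T *m (Rm *m y)) <= c * (opnorm Rm * enorm y).
  by rewrite (le_trans h1)// ler_wpM2l.
have s0 : 0 <= Num.sqrt (M * p)%N%:R * Delta by rewrite mulr_ge0 ?sqrtr_ge0 ?ltW.
have := ler_wpM2l s0 h3; rewrite /b -/c; set q := Num.sqrt _; set g := enorm (G^T *m _); set r := opnorm Rm; set z := enorm y; nra.
Qed.

Lemma disagreement_ultimate_bound (c1 c2 : R) (xi : R -> 'cV[R]_(N * n)) :
  0 < c1 -> 0 < c2 -> 0 < b ->
  (forall v, c1 * enorm (Pi *m v) ^+ 2 <= qform Rm (Pi *m v) /\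
      qform Rm (Pi *m v) <= c2 * enorm (Pi *m v) ^+ 2) ->
  krasowskii_solution (quantized_field D A B C Delta) xi ->
  exists2 T, 0 <= T & forall t, T <= t ->
    enorm (Pi *m xi t) <= 2 * Num.sqrt (c2 / c1) * b.
Proof.
move=> c10 c20 b0 hc /krasowskii_solution_derive[acx [Z Z0 dx]].
pose Q := Pi *m Rm *m Pi.
have sQ : Q^T = Q by rewrite /Q !trmx_mul disagreement_tr sR mulmxA.
have QE x : qform Q x = qform Rm (Pi *m x).
  by rewrite -(qform_conj Rm Pi) disagreement_tr.
(* The rate and the level come from b |y| <= (|y|^2 + b^2) / 2 and the upper bound by [c2]. The
   slack 3 c2 b^2 fills the level up to c1 (2 sqrt(c2 / c1) b)^2 = 4 c2 b^2. *)
have [|||||T T0 hT] := @ac_ultimate_bound _ (fun t => qform Q (xi t)) (2 * c2)^-1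
    (c2 * b ^+ 2) (3 * c2 * b ^+ 2) Z.
- by rewrite invr_gt0 mulr_gt0.
- by rewrite mulr_gt0 ?exprn_gt0// mulr_gt0.
- by [].
- by move=> T T0; apply: mx_ac_qform; exact: acx.
- move=> t t0 Zt; have [w wd wk] := dx t t0 Zt.
  exists (2 * dot (xi t) (Q *m w)); first exact: is_mx_derive_qform.
  rewrite (le_trans (disagreement_krasowskii wk))// QE.
  have [_ h] := hc (xi t); set y := enorm _ in h *.
  have : (2 * c2)^-1 * qform Rm (Pi *m xi t) <= y ^+ 2 / 2.
    by rewrite mulrC ler_pdivrMr ?mulr_gt0//; apply: le_trans h _; lra.
  have : (2 * c2)^-1 * (c2 * b ^+ 2) = b ^+ 2 / 2 by field; rewrite gt_eqF.
  have := sqr_ge0 (y - b); rewrite mulrBr mulNr; nra.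
exists T => // t /hT; rewrite QE => h.
have [h1 _] := hc (xi t).
have c21 : 0 <= c2 / c1 by rewrite divr_ge0 ?ltW.
rewrite -(ler_pXn2r (n := 2)) ?nnegrE ?enorm_ge0//; last first.
  by rewrite mulr_ge0 ?(ltW b0)// mulr_ge0// sqrtr_ge0.
have -> : (2 * Num.sqrt (c2 / c1) * b) ^+ 2 = 4 * (c2 / c1) * b ^+ 2.
  by rewrite exprMn [X in X * _]exprMn (sqr_sqrtr c21); ring.
rewrite -(ler_pM2l c10) (le_trans h1)// (le_trans h)//.
have -> : c1 * (4 * (c2 / c1) * b ^+ 2) = 4 * c2 * b ^+ 2.
  by field; rewrite gt_eqF.
clearbody b; lra.
Qed.

End Disagreement.

(** The ends of an edge are distinct nodes, which gives an off-diagonal entry -1/N. *)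
Lemma disagreement_neq0 : (0 < n)%N -> (0 < M)%N -> Pi != 0.
Proof.
move=> n0 M0; apply/eqP => /matrixP Pi0.
pose k := Ordinal M0; pose j := Ordinal n0.
have := Pi0 (mxtens_index (pos k, j)) (mxtens_index (neg k, j)).
rewrite tensmxE Pi_mxE mxE [X in _ + X]mxE mean_mxE !mxE.
rewrite (negPf (incidence_neq e_irr hlab k)) eqxx mulr1 sub0r => /eqP.
by rewrite oppr_eq0 invr_eq0 pnatr_eq0 -leqn0 leqNgt N0.
Qed.

Lemma incidence_tens_neq0 : (0 < p)%N -> (0 < M)%N -> D *t (1%:M : 'M[R]_p) != 0.
Proof.
move=> p0 M0; apply/eqP => /matrixP D0.
pose k := Ordinal M0; pose j := Ordinal p0.
have := D0 (mxtens_index (pos k, j)) (mxtens_index (k, j)).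
by rewrite tensmxE !mxE !eqxx mulr1 => /eqP; rewrite oner_eq0.
Qed.

End QuantizedConsensus.

Theorem theorem3 (R : realType) (N M n p : nat)
  (hN : (2 <= N)%N)
  (e : rel 'I_N) (e_sym : symmetric e) (e_irr : irreflexive e)
  (e_conn : connected_graph e)
  (pos neg : 'I_M -> 'I_N) (hlab : edge_labelling e pos neg)
  (D : 'M[R]_(N, M)) (hD : D = incidence_mx pos neg)
  (A : 'M[R]_n) (B : 'M[R]_(n, p)) (C : 'M[R]_(p, n))
  (hB : \rank B = p)
  (hP : exists P : 'M[R]_n,
      [/\ P = P^T, posdef P, neg_semidef (A^T *m P + P *m A)
        & B^T *m P = C])
  (hdet : detectable C A)
  (Delta : R) (hDelta : 0 < Delta)
  (c1 c2 : R) (hc1 : 0 < c1) (hc2 : 0 < c2)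
  (hc : forall x v : 'cV[R]_(N * n), x = disagreement_mx *m v ->
      c1 * enorm x ^+ 2 <= qform (R_mx D A B C) x /\
      qform (R_mx D A B C) x <= c2 * enorm x ^+ 2)
  (xi : R -> 'cV[R]_(N * n))
  (hxi : krasowskii_solution (quantized_field D A B C Delta) xi) :
  (exists2 T : R, 0 <= T & forall t : R, T <= t ->
      (Num.sqrt ((p * M)%N%:R))^-1
        * enorm (xi t - (ones *t (1%:M : 'M[R]_n)) *m kron_average (xi t))
      <= 2 * Num.sqrt (c2 / c1) * opnorm (R_mx D A B C) * opnorm B
           * opnorm (D *t (1%:M : 'M[R]_p)) * Delta) /\
  ((exists xi0 : R -> 'cV[R]_n, linear_solution A (average (xi 0)) xi0) /\
   (forall xi0 : R -> 'cV[R]_n, linear_solution A (average (xi 0)) xi0 ->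
      forall t : R, 0 <= t -> average (xi t) = xi0 t)).
Proof.
have N0 : (0 < N)%N by exact: ltnW.
have [P [sP pP nP hBP]] := hP.
have [Q [sQ pQ [eta eta0 hQ]]] :=
  network_strict_lyapunov N0 e_irr e_conn hlab sP pP nP hBP hdet.
have Pi_At := disagreement_A_tilde (n := n) e_irr hlab A B C.
subst D; set D := incidence_mx pos neg in hQ Pi_At hc hxi *.
have hQ' x : disagreement_mx *m x = x ->
    2 * dot x (Q *m (A_tilde D A B C *m x)) <= - (eta * dot x x).
  by move=> Pix; apply: hQ; rewrite -Pix mulmxA (mean_disagreement N0) mul0mx.
have [sR lyapR] := gramian_lyapunov (disagreement_tr (N := N) (n := n))
  (disagreement_idem N0) Pi_At sQ pQ eta0 hQ' (erefl (R_mx D A B C)).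
split.
  (* If pM = 0, the inverse of the zero square root is 0 and so is the left side. *)
  have [pM0|pM0] := posnP (p * M)%N.
    exists 0 => // t _; rewrite pM0 sqrtr0 invr0 mul0r.
    by rewrite !mulr_ge0 ?opnorm_ge0 ?sqrtr_ge0// ltW.
  have [p0 M0] : (0 < p)%N /\ (0 < M)%N by move: pM0; rewrite muln_gt0 => /andP.
  have B0 : B != 0.
    by apply/eqP => B0; move: hB p0; rewrite B0 mxrank0 => <-.
  have n0 : (0 < n)%N.
    by rewrite (leq_trans p0)// -hB rank_leq_row.
  (* By the Lyapunov equation, a zero Gramian would make the disagreement projection zero. *)
  have R0 : R_mx D A B C != 0.
    apply/eqP => R0; have /eqP := disagreement_neq0 (R := R) N0 e_irr hlab n0 M0.
    by apply; apply/eqP; rewrite -oppr_eq0 -lyapR R0 mulmx0 mul0mx addr0.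
  have sq0 : 0 < Num.sqrt (M * p)%N%:R :> R by rewrite sqrtr_gt0 ltr0n mulnC.
  have [|||||T T0 hT] := disagreement_ultimate_bound N0 e_irr hlab sR lyapR hDelta
    (c1 := c1) (c2 := c2) (xi := xi).
  - by [].
  - by [].
  - rewrite !mulr_gt0// opnorm_gt0//.
    exact: incidence_tens_neq0.
  - by move=> v; exact: hc.
  - by [].
  exists T => // t /hT h.
  rewrite consensus_projection mulnC mulrC ler_pdivrMr//; apply: le_trans h _.
  by rewrite le_eqVlt; apply/orP; left; apply/eqP; ring.
have [acx [Z Z0 dx]] := krasowskii_solution_derive hxi.
split.
  by exists (fun t => expmx (t *: A) *m average (xi 0)); exact: expmx_linear_solution.
move=> xi0 sol t t0.
have [x00 _ dxi0] := sol.
pose eta1 s := average_mx *m xi s - xi0 s.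
suff : eta1 t = 0 by rewrite /eta1 average_mxE => /eqP; rewrite subr_eq0 => /eqP.
have [t00|t00] := eqVneq t 0.
  by rewrite /eta1 t00 x00 average_mxE subrr.
have tp : 0 < t by rewrite lt_neqAle eq_sym t00.
(* [linear_solution] gives a two-sided derivative only for positive times, so 0 joins the
   exceptional set. *)
have Z1 : (@lebesgue_measure R).-negligible (Z `|` [set 0]).
  by apply: negligibleU => //; apply/negligibleP; [exact: measurable_set1|exact: lebesgue_measure_set1].
apply: (ac_linear_zero (A := A) t0 Z1).
- apply: mx_ac_sub; first by apply: mx_ac_mull; exact: acx.
  exact: linear_solution_mx_ac sol t0.
- move=> s s0 st /not_orP [Zs sn0].
  have sp : 0 < s by rewrite lt_neqAle eq_sym s0 andbT; apply/eqP.
  have [w wd wk] := dx s s0 Zs.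
  rewrite /eta1 mulmxBr -(average_krasowskii e_irr hlab hDelta wk).
  apply: is_mx_derive_sub; first exact: is_mx_derive_mull.
  exact/is_derive_mx/dxi0.
- by rewrite /eta1 x00 average_mxE subrr.
Qed.
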